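(* Let $\mathbb{F}=\mathbb{R}$ or $\mathbb{F}=\mathbb{C}$. Let $\Gamma$ be a distance-regular graph with vertex set $X$ and diameter $D\ge 3$, let $\{E_i\}_{i=0}^D$ be a $Q$-polynomial ordering of its primitive idempotents, let $x\in X$, and let $T=T^{\mathbb{F}}(x)$ be the Terwilliger algebra of $\Gamma$ with respect to $x$ over $\mathbb{F}$. Then the algebras $$E_1^*TE_1^*,\qquad E_1TE_1,\qquad E_D^*TE_D^*,\qquad E_DTE_D$$ are commutative. Moreover, every element of each of these algebras is a symmetric matrix.
   Context: $\Gamma$ is a finite, undirected, connected graph without loops or multiple edges, with vertex set $X$, path-length distance $\partial$ and diameter $D=\max\{\partial(y,z)\mid y,z\in X\}$. It is distance-regular: for all $0\le h,i,j\le D$ and all $y,z\in X$ with $\partial(y,z)=h$, the number $p^h_{i,j}=|\{w\in X\mid \partial(y,w)=i,\ \partial(z,w)=j\}|$ depends only on $h,i,j$. All matrices have rows and columns indexed by $X$. The adjacency matrix $A$ has $D+1$ distinct real eigenvalues $\theta_0,\dots,\theta_D$, with $\theta_0$ equal to the valency; the primitive idempotent $E_i$ is the matrix of the orthogonal projection onto the $\theta_i$-eigenspace of $A$. With $\circ$ the entrywise product, the Krein parameters $q^h_{i,j}$ are defined by $E_i\circ E_j=|X|^{-1}\sum_{h=0}^D q^h_{i,j}E_h$. The ordering $\{E_i\}_{i=0}^D$ is $Q$-polynomial if for all $0\le h,i,j\le D$: $q^h_{i,j}=0$ whenever one of $h,i,j$ is greater than the sum of the other two, and $q^h_{i,j}\ne0$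 whenever one of $h,i,j$ equals the sum of the other two. For $0\le i\le D$, $E_i^*=E_i^*(x)$ is the diagonal matrix with $(y,y)$-entry $1$ if $\partial(x,y)=i$ and $0$ otherwise. The Terwilliger algebra $T$ is the $\mathbb{F}$-subalgebra of the algebra $\mathrm{Mat}_X(\mathbb{F})$ of matrices with entries in $\mathbb{F}$ generated by $A$ and $E_0^*,\dots,E_D^*$. The set $E_i^*TE_i^*=\{E_i^*BE_i^*\mid B\in T\}$ is an algebra with multiplicative identity $E_i^*$, and $E_iTE_i=\{E_iBE_i\mid B\in T\}$ is an algebra with multiplicative identity $E_i$. ''Symmetric'' means $B^\top=B$ (transpose without conjugation, also when $\mathbb{F}=\mathbb{C}$). *)

(* Defs.v *)
From HB Require Import structures.
From mathcomp Require Import all_boot all_order all_algebra.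
From mathcomp Require Import classical_sets reals.
From mathcomp Require Import complex.
Set Implicit Arguments.
Unset Strict Implicit.
Unset Printing Implicit Defensive.
Import Order.TTheory GRing.Theory Num.Theory.
Local Open Scope ring_scope.

Section Graph.
Variables (X : finType) (e : rel X).

Definition walk (n : nat) (y z : X) : bool :=
  [exists p : n.-tuple X, path e y p && (last y p == z)].

(* In a connected graph all distances are < #|X|, so the search range is large
   enough; vertices in different components would get the junk value #|X|. *)
Definition gdist (y z : X) : nat :=
  find (fun n => walk n y z) (iota 0 #|X|).

Definition diameter : nat := \max_(y : X) \max_(z : X) gdist y z.

Definition distance_regular : Prop :=
  exists p : nat -> nat -> nat -> nat,
  forall h i j : nat,
    (h <= diameter)%N -> (i <= diameter)%N -> (j <= diameter)%N ->
  forall y z : X, gdist y z = h ->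
    #|[pred w : X | (gdist y w == i) && (gdist z w == j)]| = p h i j.

End Graph.

(* Matrices indexed by X are indexed by 'I_#|X| through enum_val.             *)
Section Matrices.
Variables (X : finType) (e : rel X).

Definition adj_mx (F : nzRingType) : 'M[F]_#|X| :=
  \matrix_(i, j) (e (enum_val i) (enum_val j))%:R.

Definition dual_idem (F : nzRingType) (x : X) (i : nat) : 'M[F]_#|X| :=
  \matrix_(j, k) ((j == k) && (gdist e x (enum_val j) == i))%:R.

(* Vectors are row vectors, matrices acting on the right, as in mxalgebra.    *)
Definition orthogonal_projection (R : fieldType) (n : nat) (P V : 'M[R]_n) :
    Prop :=
  forall v : 'rV[R]_n,
    (v *m P <= V)%MS /\
    forall w : 'rV[R]_n, (w <= V)%MS -> (v - v *m P) *m w^T = 0.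

Definition eigenvalue_ordering (R : fieldType)
    (theta : 'I_(diameter e).+1 -> R) : Prop :=
  [/\ injective theta,
      forall a : R, eigenvalue (adj_mx R) a <-> exists i, theta i = a &
      forall y : X, theta ord0 = #|[pred z : X | e y z]|%:R].

(* As A is symmetric, its row and column eigenspaces agree up to transposition,
   and so do the matrices of the two projections. *)
Definition primitive_idempotents (R : fieldType)
    (theta : 'I_(diameter e).+1 -> R)
    (E : 'I_(diameter e).+1 -> 'M[R]_#|X|) : Prop :=
  forall i, orthogonal_projection (E i) (eigenspace (adj_mx R) (theta i)).

(* q h i j stands for q^h_{i,j}. *)
Definition krein_parameters (R : fieldType) (d : nat)
    (E : 'I_d.+1 -> 'M[R]_#|X|) (q : 'I_d.+1 -> 'I_d.+1 -> 'I_d.+1 -> R) :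
    Prop :=
  forall i j,
    map2_mx *%R (E i) (E j) = #|X|%:R^-1 *: \sum_h q h i j *: E h.

(* The Krein parameters are unique because the E_h are linearly independent.  *)
Definition Q_polynomial (R : fieldType) (d : nat)
    (E : 'I_d.+1 -> 'M[R]_#|X|) : Prop :=
  exists q : 'I_d.+1 -> 'I_d.+1 -> 'I_d.+1 -> R,
    krein_parameters E q /\
    forall h i j : 'I_d.+1,
      ([|| (h > i + j)%N, (i > h + j)%N | (j > h + i)%N] -> q h i j = 0) /\
      ([|| (h == i + j :> nat)%N, (i == h + j :> nat)%N | (j == h + i :> nat)%N] ->
         q h i j != 0).

End Matrices.

Section Algebras.
Variables (F : fieldType) (n : nat).

Inductive generated_subalgebra (G : set 'M[F]_n) : set 'M[F]_n :=
| gensub_gen B : G B -> generated_subalgebra G B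
| gensub_one : generated_subalgebra G 1%:M
| gensub_scale (a : F) B :
    generated_subalgebra G B -> generated_subalgebra G (a *: B)
| gensub_add B C : generated_subalgebra G B -> generated_subalgebra G C ->
    generated_subalgebra G (B + C)
| gensub_mul B C : generated_subalgebra G B -> generated_subalgebra G C ->
    generated_subalgebra G (B *m C).

Definition corner (P : 'M[F]_n) (T : set 'M[F]_n) : set 'M[F]_n :=
  [set P *m B *m P | B in T]%classic.

Definition commutative_set (S : set 'M[F]_n) : Prop :=
  forall B C, S B -> S C -> B *m C = C *m B.

Definition symmetric_set (S : set 'M[F]_n) : Prop :=
  forall B, S B -> B^T = B.

End Algebras.

Definition terwilliger (X : finType) (e : rel X) (F : fieldType) (x : X) :
    set 'M[F]_#|X| :=
  generated_subalgebra
    (fun B => B = adj_mx e F \/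
       exists2 i : nat, (i <= diameter e)%N & B = dual_idem e F x i).

Arguments terwilliger {X} e F x _.

(* The two choices of scalars; the primitive idempotents are real matrices and
   are viewed over either field through [of_real]. *)
Variant scalars := RealScalars | ComplexScalars.

Definition scalar_field (R : realType) (k : scalars) : fieldType :=
  match k with
  | RealScalars => R : fieldType
  | ComplexScalars => R[i] : fieldType
  end.

Definition of_real (R : realType) (k : scalars) : R -> scalar_field R k :=
  match k return R -> scalar_field R k with
  | RealScalars => id
  | ComplexScalars => fun a => a%:C%C
  end.
Arguments of_real {R} k a.

(* Main.v *)
(* Transposition is an antiautomorphism of T, so commutativity follows once all
   elements of the corners are known to be symmetric.

   Let p' be the projection onto the primary module and p = 1 - p'. It is central
   for T, the primary part of T consists of matrices constant on pairs of
   spheres around x, and these contribute only symmetric matrices to the corners.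
   On the image of p the idempotents E_1, ..., E_D and E_1^*, ..., E_D^* form a
   tridiagonal system in which each of E_1^*, E_D^*, E_1, E_D is an end f_0 of
   its family. Write B for the operator of that family and A for the operator
   of the other one; it remains to see that f_0 T f_0 is symmetric:

   - the elements f_0 P(A) f_0 commute. By tridiagonality
     f_0 (P(A) Q(B) R(A) - R(A) Q(B) P(A)) f_0 is an alternating form in
     (P, R), banded of width deg Q, and (by induction on deg Q) it vanishes when
     deg R < deg Q; a Vandermonde argument then kills it row by row;

   - f_0 T f_0 is generated by the elements f_0 P(A) f_0. In an alternating word
     P_1(A) Q_1(B) P_2(A) ... a letter of degree k is banded of width k, so its
     two neighbours may be replaced by pairs in which the left one has degree < k
     or the right one has degree <= k. Moving right, the letter of degree k
     reaches the end of the word, where f_0 either lowers its left neighbour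
     below degree k or splits the word.

   As the generators are symmetric and commute, f_0 T f_0 is symmetric. *)

Require Import Defs.
From HB Require Import structures.
From mathcomp Require Import all_boot all_order all_algebra.
From mathcomp Require Import classical_sets reals.
From mathcomp Require Import complex.
Set Implicit Arguments.
Unset Strict Implicit.
Unset Printing Implicit Defensive.
Import Order.TTheory GRing.Theory Num.Theory.
Local Open Scope ring_scope.

(** * Tridiagonal systems *)

Section Generated.
Variables (F : fieldType) (n : nat).
Implicit Types (G S : set 'M[F]_n) (B C : 'M[F]_n).

Definition lin_closed S : Prop :=
  S 0 /\ forall a B C, S B -> S C -> S (a *: B + C).

Lemma lin_closedD S B C : lin_closed S -> S B -> S C -> S (B + C).
Proof. by case=> _ SD SB SC; rewrite -[B]scale1r; apply: SD. Qed.

Lemma lin_closedZ S a B : lin_closed S -> S B -> S (a *: B).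
Proof. by case=> S0 SD SB; rewrite -[_ *: _]addr0; apply: SD. Qed.

Lemma lin_closed_sum S (I : Type) (r : seq I) (P : pred I)
    (B : I -> 'M[F]_n) :
  lin_closed S -> (forall i, P i -> S (B i)) -> S (\sum_(i <- r | P i) B i).
Proof.
move=> Slin SB; apply: (big_ind S) => //; first by case: Slin.
by move=> C D SC SD; apply: lin_closedD.
Qed.

Lemma gensub_lin G : lin_closed (generated_subalgebra G).
Proof.
split; last by move=> a B C GB GC; apply: gensub_add => //; apply: gensub_scale.
by rewrite -(scale0r 1%:M); apply/gensub_scale/gensub_one.
Qed.

Lemma gensub_comm G B :
  (forall C, G C -> B *m C = C *m B) ->
  forall C, generated_subalgebra G C -> B *m C = C *m B.
Proof.
move=> GB C; elim=> {C} [C /GB //||a C _ IH|C D _ IHC _ IHD|C D _ IHC _ IHD].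
- by rewrite mulmx1 mul1mx.
- by rewrite -scalemxAr -scalemxAl IH.
- by rewrite mulmxDr mulmxDl IHC IHD.
- by rewrite mulmxA IHC -mulmxA IHD mulmxA.
Qed.

(** Commutation passes from G to the generated algebra in one argument at a time, and a product of
    commuting symmetric matrices is symmetric. *)
Lemma gensub_symmetric G :
  commutative_set G -> symmetric_set G ->
  symmetric_set (generated_subalgebra G).
Proof.
move=> Gcomm Gsym B.
have comm C D : generated_subalgebra G C -> generated_subalgebra G D ->
    C *m D = D *m C.
  move=> GC GD; apply: gensub_comm GD => D' GD'.
  by apply/esym/(gensub_comm _ GC) => C' GC'; apply: Gcomm.
elim=> {B} [B /Gsym //||a B _ IH|B C _ IHB _ IHC|B C GB IHB GC IHC].
- by rewrite trmx1.
- by rewrite linearZ /= IH.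
- by rewrite linearD /= IHB IHC.
- by rewrite trmx_mul IHB IHC comm.
Qed.

End Generated.

(** Serves to bound the degrees of polynomials that interpolate or vanish on an interval of
    indices. *)
Lemma card_ord_itv (m a b : nat) (A : pred 'I_m) :
  (forall i, A i -> (a <= i < a + b)%N) -> (#|A| <= b)%N.
Proof.
move=> Aab; rewrite -[leqRHS](size_iota a) cardE -(size_map (@nat_of_ord m)).
apply: uniq_leq_size; first by rewrite map_inj_uniq ?enum_uniq //; apply: ord_inj.
move=> j; case/mapP => i; rewrite mem_enum => /Aab iab ->; by rewrite mem_iota.
Qed.

(** * Orthogonal symmetric idempotents and polynomials in them *)

Section SpectralFamily.
Variables (F : fieldType) (n m : nat).
Variables (e : 'I_m -> 'M[F]_n) (th : 'I_m -> F).
Implicit Types (P Q : {poly F}) (i j : 'I_m).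

(** Completeness is not asked: the families in use sum to the projection onto the complement of the
    primary module, not to [1%:M]. *)
Definition spectral : Prop :=
  [/\ injective th, forall i, (e i)^T = e i &
      forall i j, e i *m e j = if i == j then e i else 0].

(* [spev P] is the value of [P] at [\sum_i th i *: e i], with [\sum_i e i] as
   the identity. *)
Definition spev P : 'M[F]_n := \sum_i P.[th i] *: e i.

(** Take the remainder of P modulo the monic polynomial with roots [th i], i in A. *)
Lemma interpolation (th_inj : injective th) (A : pred 'I_m) P :
  exists Q, (size Q <= #|A|)%N /\ forall i, A i -> Q.[th i] = P.[th i].
Proof.
pose M := \prod_(i in A) ('X - (th i)%:P).
have sM : size M = #|A|.+1.
  by rewrite /M -big_enum size_prod_XsubC -cardE.
have M0 : M != 0 by rewrite -size_poly_eq0 sM.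
exists (P %% M); split; first by rewrite -ltnS -sM ltn_modp.
move=> i Ai; rewrite {2}(divp_eq P M) hornerD hornerM.
suff /eqP-> : root M (th i) by rewrite mulr0 add0r.
by rewrite /M (bigD1 i) //= rootM root_XsubC eqxx.
Qed.

Lemma spevD P Q : spev (P + Q) = spev P + spev Q.
Proof.
by rewrite -big_split; apply: eq_bigr => i _; rewrite hornerD scalerDl.
Qed.

Lemma spevZ a P : spev (a *: P) = a *: spev P.
Proof.
by rewrite scaler_sumr; apply: eq_bigr => i _; rewrite hornerZ scalerA.
Qed.

Lemma spev0 : spev 0 = 0.
Proof. by rewrite /spev big1 // => i _; rewrite horner0 scale0r. Qed.

Lemma spev1 : spev 1 = \sum_i e i.
Proof. by apply: eq_bigr => i _; rewrite hornerE scale1r. Qed.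

Hypothesis sp : spectral.

Lemma spev_tr P : (spev P)^T = spev P.
Proof.
have [_ esym _] := sp.
by rewrite linear_sum; apply: eq_bigr => i _; rewrite linearZ /= esym.
Qed.

Lemma mul_idem_spev i P : e i *m spev P = P.[th i] *: e i.
Proof.
have [_ _ eM] := sp.
rewrite mulmx_sumr (bigD1 i) //= -scalemxAr eM eqxx big1 ?addr0 // => j ji.
by rewrite -scalemxAr eM eq_sym (negPf ji) scaler0.
Qed.

Lemma mul_spev_idem i P : spev P *m e i = P.[th i] *: e i.
Proof.
have [_ esym _] := sp; rewrite -[LHS]trmxK trmx_mul spev_tr esym.
by rewrite mul_idem_spev linearZ /= esym.
Qed.

Lemma spevM P Q : spev (P * Q) = spev P *m spev Q.
Proof.
rewrite {2}/spev mulmx_suml; apply: eq_bigr => i _.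
by rewrite -scalemxAl mul_idem_spev scalerA hornerM.
Qed.

(** P is the Lagrange polynomial of the point [th i]. *)
Lemma idem_spev i : exists P, spev P = e i.
Proof.
have [th_inj _ _] := sp.
pose M := \prod_(j | j != i) ('X - (th j)%:P).
have Mi : M.[th i] != 0.
  rewrite horner_prod; apply/prodf_neq0 => j ji.
  by rewrite hornerXsubC subr_eq0 (inj_eq th_inj) eq_sym.
exists (M.[th i]^-1 *: M); rewrite spevZ /spev (bigD1 i) //= scalerDr scalerA.
rewrite mulVf // scale1r big1 ?scaler0 ?addr0 // => j ji.
by rewrite horner_prod (bigD1 j) //= hornerXsubC subrr mul0r scale0r.
Qed.

Section Banded.
Variables (k : nat) (B : 'M[F]_n).
Hypothesis Bband : forall i j, (i + k < j)%N || (j + k < i)%N ->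
  e i *m B *m e j = 0.

(* A polynomial identity on the band |i - j| <= k of the grid of eigenvalues:
   the monomials x^a y^c with a < k or c <= k already span all functions
   there. *)
Lemma banded_span (S : set 'M[F]_n) : lin_closed S ->
  (forall P Q, (size P <= k)%N || (size Q <= k.+1)%N ->
     S (spev P *m B *m spev Q)) ->
  forall P Q, S (spev P *m B *m spev Q).
Proof.
move=> Slin SB P Q.
have [th_inj _ _] := sp.
have eBev i Q1 : e i *m B *m spev Q1 = \sum_j Q1.[th j] *: (e i *m B *m e j).
  by rewrite mulmx_sumr; apply: eq_bigr => j _; rewrite -scalemxAr.
have evBe P1 j : spev P1 *m B *m e j = \sum_i P1.[th i] *: (e i *m B *m e j).
  by rewrite !mulmx_suml; apply: eq_bigr => i _; rewrite -!scalemxAl.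
have cancel (a : F) (C D : 'M[F]_n) : a != 0 -> S D -> S (a *: C + D) -> S C.
  move=> a0 SD SCD; rewrite -[C](scalerK a0) -[a *: C](addrK D).
  apply: lin_closedZ => //; apply: lin_closedD => //.
  by rewrite -scaleN1r; apply: lin_closedZ.
have size_M (A : pred 'I_m) : size (\prod_(i in A) ('X - (th i)%:P)) = #|A|.+1.
  by rewrite -big_enum size_prod_XsubC -cardE.
have root_M (A : pred 'I_m) i : A i -> (\prod_(j in A) ('X - (th j)%:P)).[th i] = 0.
  by move=> Ai; rewrite horner_prod (bigD1 i) //= hornerXsubC subrr mul0r.
have nroot_M (A : pred 'I_m) i : ~~ A i ->
    (\prod_(j in A) ('X - (th j)%:P)).[th i] != 0.
  move=> Ai; rewrite horner_prod; apply/prodf_neq0 => j Aj.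
  rewrite hornerXsubC subr_eq0 (inj_eq th_inj).
  by apply: contraNneq Ai => ->.
(* It suffices to treat single blocks; this goes by strong induction on the row i. *)
have SeBe : forall i j, S (e i *m B *m e j).
  move=> i; have [h] := ubnP i; elim: h i => // h IH i /ltnSE ih j.
  have {IH} below i' : (i' < i)%N -> forall j, S (e i' *m B *m e j).
    by move=> i'i; apply: IH; apply: leq_trans ih.
  (* Below the diagonal, M vanishes at the rows after i up to j + k, fewer than k of them as j < i.
     In [spev M *m B *m e j] the rows before i are known and those after j + k are zero, so only row
     i is left. *)
  have left : forall j, (j < i)%N -> S (e i *m B *m e j).
    move=> {}j ltji; have [far|near] := ltnP (j + k) i.
      by rewrite Bband ?far ?orbT //; case: Slin.
    pose A : pred 'I_m := fun i' => (i < i' <= j + k)%N.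
    pose M := \prod_(i' in A) ('X - (th i')%:P).
    have sM : (size M <= k)%N.
      rewrite size_M; apply: (@leq_ltn_trans (j + k - i)).
        apply: (@card_ord_itv m i.+1 _ A) => i' /andP[-> /=].
        by rewrite addSn ltnS subnKC.
      by rewrite ltn_subLR // ltn_add2r.
    have [R eR] := idem_spev j.
    have := SB M R; rewrite sM => /(_ isT); rewrite eR evBe (bigD1 i) //=.
    apply: cancel; first by apply: nroot_M; rewrite /A ltnn.
    apply: lin_closed_sum => // i' i'i.
    have [/below /(_ j) Sb|] := ltnP i' i; first exact: lin_closedZ.
    rewrite leq_eqVlt val_eqE eq_sym (negPf i'i) /= => lti.
    have [far'|near'] := ltnP (j + k) i'.
      by rewrite Bband ?far' ?orbT // scaler0; case: Slin.
    by rewrite root_M ?scale0r /A ?lti //; case: Slin.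
  have [/left//|leij] := ltnP j i; have [far|near] := ltnP (i + k) j.
    by rewrite Bband ?far //; case: Slin.
  (* On or above the diagonal, M vanishes at the other columns from i to i + k, at most k of them.
     The columns before i are covered by [left], those after i + k are zero. *)
  pose A : pred 'I_m := fun j' => (i <= j' <= i + k)%N && (j' != j).
  pose M := \prod_(j' in A) ('X - (th j')%:P).
  have sM : (size M <= k.+1)%N.
    rewrite size_M ltnS -ltnS.
    have <- : #|[predU1 j & A]| = #|A|.+1 by rewrite cardU1 unfold_in /A eqxx andbF.
    apply: (@card_ord_itv m i _ (predU1 j A)) => j' /=; rewrite addnS ltnS.
    by case/orP=> [/eqP->|/andP[]//]; rewrite leij near.
  have [R eR] := idem_spev i.
  have := SB R M; rewrite sM orbT => /(_ isT); rewrite eR eBev (bigD1 j) //=.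
  apply: cancel; first by apply: nroot_M; rewrite /A eqxx andbF.
  apply: lin_closed_sum => // j' j'j.
  have [far'|near'] := ltnP (i + k) j'.
    by rewrite Bband ?far' // scaler0; case: Slin.
  have [ltj|lej] := ltnP j' i; last first.
    by rewrite root_M ?scale0r /A ?lej ?near' //; case: Slin.
  by apply: lin_closedZ => //; apply: left.
rewrite {1}/spev !mulmx_suml; apply: lin_closed_sum => // i _.
rewrite -!scalemxAl eBev; apply: lin_closedZ => //.
by apply: lin_closed_sum => // j _; apply: lin_closedZ.
Qed.

End Banded.
End SpectralFamily.

(** * The corner at an end of a tridiagonal system *)

Section TridiagonalSystem.
Variables (F : fieldType) (n m : nat).
Variables (g : bool -> 'I_m -> 'M[F]_n) (th : bool -> 'I_m -> F).
Implicit Types (P Q R : {poly F}) (i j : 'I_m) (b : bool).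

Notation ev b := (spev (g b) (th b)).

(* [g true] and [g false] play the roles of the E_i and of the E_i^* of a
   tridiagonal system. *)
Record tridiagonal_system : Prop := TridiagonalSystem {
  td_spectral b : spectral (g b) (th b);
  td_sum : \sum_i g true i = \sum_i g false i;
  td_tridiagonal b i j :
    (i.+1 < j)%N -> g b i *m ev (~~ b) 'X *m g b j = 0 }.

Hypothesis td : tridiagonal_system.

Let inj b : injective (th b). Proof. by case: (td_spectral td b). Qed.
Let gsym b i : (g b i)^T = g b i. Proof. by case: (td_spectral td b). Qed.

Lemma td_ev1 b c : ev b 1 = ev c 1.
Proof. by rewrite !spev1; case: b c => [] []; rewrite ?(td_sum td). Qed.

Lemma td_ev1l b c P : ev b 1 *m ev c P = ev c P.
Proof. by rewrite (td_ev1 b c) -(spevM (td_spectral td c)) mul1r. Qed.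

Lemma td_ev1r b c P : ev c P *m ev b 1 = ev c P.
Proof. by rewrite (td_ev1 b c) -(spevM (td_spectral td c)) mulr1. Qed.

Lemma td_idem1r b c i : g c i *m ev b 1 = g c i.
Proof.
by rewrite (td_ev1 b c) (mul_idem_spev (td_spectral td c)) hornerE scale1r.
Qed.

(** Each factor of the other operator moves the index by at most one, and [size P] exceeds the
    degree by one. Transposition exchanges the two alternatives. *)
Lemma td_band b P i j :
  (i + size P <= j)%N || (j + size P <= i)%N ->
  g b i *m ev (~~ b) P *m g b j = 0.
Proof.
wlog leij : i j / (i + size P <= j)%N => [hw /orP[le|le]|_].
- by apply: hw => //; rewrite le.
- apply: trmx_inj; rewrite !trmx_mul trmx0 !gsym (spev_tr (td_spectral td _)).
  by rewrite mulmxA; apply: hw => //; rewrite le.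
have insert (C D : 'M_n) : C *m ev b 1 *m D = \sum_l C *m g b l *m D.
  by rewrite spev1 mulmx_sumr mulmx_suml.
have bandXn k : forall i j, (i + k < j)%N ->
    g b i *m ev (~~ b) 'X^k *m g b j = 0.
  elim: k => [|k IH] {leij}i {}j ltij.
    have [_ _ gM] := td_spectral td b.
    rewrite expr0 td_idem1r gM; case: eqP => // ij.
    by rewrite ij addn0 ltnn in ltij.
  (* The common identity, resolved into the [g b l], is inserted before the last factor. *)
  have -> : g b i *m ev (~~ b) 'X^(k.+1) *m g b j = \sum_l
      (g b i *m ev (~~ b) 'X^k *m g b l) *m (g b l *m ev (~~ b) 'X *m g b j).
    rewrite exprSr (spevM (td_spectral td _)) -{1}(td_ev1l b (~~ b) 'X).
    rewrite !mulmxA -(mulmxA _ _ (g b j)) insert; apply: eq_bigr => l _.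
    have [_ _ gM] := td_spectral td b.
    by rewrite !mulmxA -(mulmxA _ (g b l) (g b l)) gM eqxx.
  rewrite big1 // => l _; have [lt_il|le_li] := ltnP (i + k) l.
    by rewrite IH // mul0mx.
  rewrite (td_tridiagonal td) ?mulmx0 //.
  by rewrite (leq_ltn_trans _ ltij) // addnS ltnS.
rewrite -(coefK P) poly_def (big_morph _ (spevD _ _) (spev0 _ _)).
rewrite mulmx_sumr mulmx_suml big1 // => k _.
rewrite spevZ -scalemxAr -scalemxAl bandXn ?scaler0 //.
by rewrite (leq_trans _ leij) // ltn_add2l.
Qed.

Variable i0 : 'I_m.
Hypothesis i0_0 : i0 = 0 :> nat.

Let f0 := g false i0.
Let f0f0 : f0 *m f0 = f0.
Proof. by case: (td_spectral td false) => _ _ ->; rewrite eqxx. Qed.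

(** As [f0] has index 0, [td_band] kills the terms with index at least [size Q]. *)
Lemma td_corner_reduce P Q (A : pred 'I_m) :
  (forall j, A j -> (size Q <= j)%N) ->
  ev false P *m ev true Q *m f0 =
  \sum_(j | ~~ A j) P.[th false j] *: (g false j *m ev true Q *m f0).
Proof.
move=> QA; rewrite {1}/spev !mulmx_suml (bigID A) /= big1 ?add0r.
  by apply: eq_bigr => j _; rewrite -!scalemxAl.
move=> j Aj; rewrite -!scalemxAl (@td_band false) ?scaler0 //.
by rewrite i0_0 add0n QA ?orbT.
Qed.

(* Against [ev true Q *m f0], only the values of [P] at the first [size Q]
   points matter. *)
Lemma td_shorten k P Q : (size Q <= k)%N ->
  exists P', (size P' <= k)%N /\
    ev false P *m ev true Q *m f0 = ev false P' *m ev true Q *m f0.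
Proof.
move=> sQ; pose A : pred 'I_m := fun j => (j < k)%N.
have [P' [sP' eP']] := interpolation (@inj false) A P.
exists P'; split.
  by apply: leq_trans sP' _; apply: (@card_ord_itv m 0).
rewrite !(@td_corner_reduce _ _ (fun j => (k <= j)%N)); try by move=> j; apply: leq_trans.
by apply: eq_bigr => j; rewrite -ltnNge => Aj; rewrite eP'.
Qed.

(** Only the points 0, ..., k matter. P' interpolates P at the k points 1, ..., k, and c is the
    error left at the point 0. *)
Lemma td_peel k P Q : (size Q <= k.+1)%N ->
  exists c P', (size P' <= k)%N /\
    ev false P *m ev true Q *m f0 =
    c *: (f0 *m ev true Q *m f0) + ev false P' *m ev true Q *m f0.
Proof.
move=> sQ; pose A : pred 'I_m := fun j => (0 < j <= k)%N.
have [P' [sP' eP']] := interpolation (@inj false) A P.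
exists (P.[th false i0] - P'.[th false i0]), P'; split.
  by apply: leq_trans sP' _; apply: (@card_ord_itv m 1) => j; rewrite add1n ltnS.
rewrite !(@td_corner_reduce _ _ (fun j => (k < j)%N)); try by move=> j; apply: leq_trans.
rewrite (bigD1 i0) ?[X in _ = _ + X](bigD1 i0) ?i0_0 //=.
rewrite addrA -scalerDl subrK; congr (_ + _); apply: eq_bigr => j.
rewrite -leqNgt => /andP[jk ji0]; rewrite eP' // /A jk andbT lt0n.
by apply: contraNneq ji0 => j0; apply/eqP/ord_inj; rewrite j0.
Qed.

(* The difference of the two sides is an alternating form in (P, R), banded on
   the [g true i] and vanishing when [size R < size Q]; it is killed row by
   row. *)
Lemma td_corner_swap Q P R :
  f0 *m ev true P *m ev false Q *m ev true R *m f0 =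
  f0 *m ev true R *m ev false Q *m ev true P *m f0.
Proof.
have [k sQ] : exists k, (size Q <= k)%N by exists (size Q).
elim: k Q sQ P R => [|k IH] Q sQ P R.
  by move: sQ; rewrite leqn0 size_poly_eq0 => /eqP->; rewrite spev0 !(mulmx0, mul0mx).
have w_tr Q1 P1 R1 : f0 *m ev true P1 *m ev false Q1 *m ev true R1 *m f0 =
    (f0 *m ev true R1 *m ev false Q1 *m ev true P1 *m f0)^T.
  by rewrite !trmx_mul !(spev_tr (td_spectral td _)) gsym !mulmxA.
(* A short R1 allows Q to be replaced by a polynomial of size at most k, to which the induction
   hypothesis applies; the other side is the transpose. *)
have fP P1 R1 : (size R1 <= k)%N ->
    f0 *m ev true P1 *m ev false Q *m ev true R1 *m f0 =
    f0 *m ev true R1 *m ev false Q *m ev true P1 *m f0.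
  move=> sR1; have [Q' [sQ' eQ']] := td_shorten Q sR1.
  suff eQ : f0 *m ev true P1 *m ev false Q *m ev true R1 *m f0 =
      f0 *m ev true P1 *m ev false Q' *m ev true R1 *m f0.
    by rewrite [RHS]w_tr eQ -w_tr IH.
  by rewrite -!mulmxA; congr (_ *m (_ *m _)); rewrite !mulmxA eQ'.
pose t i j := f0 *m g true i *m ev false Q *m g true j *m f0.
have t_far i j : (i + k < j)%N || (j + k < i)%N -> t i j = 0.
  move=> far; have Z : g true i *m ev false Q *m g true j = 0.
    apply: (@td_band true); case/orP: far => far; apply/orP; [left|right].
      by rewrite (leq_trans _ far) // -addnS leq_add2l.
    by rewrite (leq_trans _ far) // -addnS leq_add2l.
  transitivity (f0 *m (g true i *m ev false Q *m g true j) *m f0).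
    by rewrite /t !mulmxA.
  by rewrite Z mulmx0 mul0mx.
have expandr (C D : 'M_n) R1 :
    C *m ev true R1 *m D = \sum_j R1.[th true j] *: (C *m g true j *m D).
  rewrite mulmx_sumr mulmx_suml; apply: eq_bigr => j _.
  by rewrite -scalemxAr -scalemxAl.
have expandl C P1 R1 :
    f0 *m ev true P1 *m C *m ev true R1 *m f0 =
    \sum_i P1.[th true i] *: (f0 *m g true i *m (C *m ev true R1 *m f0)).
  by rewrite -expandr !mulmxA.
(* Row by row: M vanishes at the points from i + 1 to i + k other than j, so its size is at most k
   and [fP] applies to [g true i] and M. Indices l < i are known, l = i is trivial and l > i + k is
   off the band, which leaves l = j. *)
have t_sym : forall i j, t i j = t j i.
  move=> i; have [h] := ubnP i; elim: h i => // h IHh i /ltnSE ih j.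
  have [ltji|] := ltnP j i; first by rewrite (IHh j) // (leq_trans ltji).
  rewrite leq_eqVlt => /orP[/eqP/ord_inj -> //|ltij].
  have [far|near] := ltnP (i + k) j; first by rewrite !t_far ?far ?orbT.
  pose A : pred 'I_m := fun l => (i < l <= i + k)%N && (l != j).
  pose M := \prod_(l in A) ('X - (th true l)%:P).
  have sM : (size M <= k)%N.
    rewrite /M -big_enum size_prod_XsubC -cardE.
    have <- : #|[predU1 j & A]| = #|A|.+1 by rewrite cardU1 unfold_in /A eqxx andbF.
    apply: (@card_ord_itv m i.+1 _ (predU1 j A)) => l /=; rewrite addSn ltnS.
    by case/orP=> [/eqP->|/andP[]//]; rewrite ltij near.
  have [P1 eP1] := idem_spev (td_spectral td true) i.
  have : \sum_l M.[th true l] *: t i l = \sum_l M.[th true l] *: t l i.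
    rewrite -expandr -eP1 fP // expandl eP1.
    by apply: eq_bigr => l _; rewrite /t !mulmxA.
  rewrite (bigD1 j) //= [RHS](bigD1 j) //=.
  have -> : \sum_(l | l != j) M.[th true l] *: t i l =
            \sum_(l | l != j) M.[th true l] *: t l i.
    apply: eq_bigr => l lj; have [ltli|leil] := ltnP l i.
      by rewrite (IHh l) // (leq_trans ltli).
    have [farl|nearl] := ltnP (i + k) l; first by rewrite !t_far ?farl ?orbT.
    move: leil; rewrite leq_eqVlt => /orP[/eqP/ord_inj -> //|ltil].
    suff -> : M.[th true l] = 0 by rewrite !scale0r.
    by rewrite /M horner_prod (bigD1 l) /= ?unfold_in /A ?ltil ?nearl //
       hornerXsubC subrr mul0r.
  move/addIr/scalerI; apply.
  rewrite /M horner_prod; apply/prodf_neq0 => l Al.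
  rewrite hornerXsubC subr_eq0 (inj_eq (@inj true)).
  by apply: contraTneq Al => <-; rewrite unfold_in /A eqxx andbF.
have expand P1 R1 : f0 *m ev true P1 *m ev false Q *m ev true R1 *m f0 =
    \sum_i \sum_j (P1.[th true i] * R1.[th true j]) *: t i j.
  rewrite expandl; apply: eq_bigr => i _; rewrite !mulmxA expandr scaler_sumr.
  by apply: eq_bigr => j _; rewrite scalerA.
rewrite !expand exchange_big; apply: eq_bigr => i _; apply: eq_bigr => j _.
by rewrite t_sym mulrC.
Qed.

Fixpoint td_word b (s : seq {poly F}) : 'M[F]_n :=
  if s is P :: s' then ev b P *m td_word (~~ b) s' else ev b 1.

Lemma td_word1l b c s : ev c 1 *m td_word b s = td_word b s.
Proof. by case: s => [|P s] /=; rewrite ?mulmxA td_ev1l. Qed.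

Lemma td_word_cat b s1 s2 :
  td_word b (s1 ++ s2) = td_word b s1 *m td_word (b (+) odd (size s1)) s2.
Proof.
elim: s1 b => [|P s1 IH] b /=; first by rewrite addbF td_word1l.
by rewrite IH mulmxA addbN addNb.
Qed.

Definition td_corner_gen : set 'M[F]_n :=
  fun B => exists P, B = f0 *m ev true P *m f0.

Notation C0 := (generated_subalgebra td_corner_gen).

(** This is [td_corner_swap] with [f0] itself as the middle letter. *)
Lemma td_corner_gen_comm : commutative_set td_corner_gen.
Proof.
move=> _ _ [P ->] [Q ->]; have [L eL] := idem_spev (td_spectral td false) i0.
have := td_corner_swap L P Q; rewrite eL -/f0 => sw.
by rewrite !mulmxA -!(mulmxA _ f0 f0) f0f0.
Qed.

Lemma td_corner_gen_sym : symmetric_set td_corner_gen.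
Proof.
move=> _ [P ->].
by rewrite !trmx_mul (spev_tr (td_spectral td _)) gsym mulmxA.
Qed.

Lemma td_word_split b s1 P Q R s2 :
  td_word b (s1 ++ [:: P, Q, R & s2]) =
  td_word b s1 *m (ev (b (+) odd (size s1)) P *m
    ev (~~ (b (+) odd (size s1))) Q *m ev (b (+) odd (size s1)) R) *m
    td_word (~~ (b (+) odd (size s1))) s2.
Proof. by rewrite td_word_cat /= negbK !mulmxA. Qed.

(* The bound [k] moves one letter to the right at each application of
   [banded_span], up to the last letter, where [td_peel] lowers it. *)
Lemma td_word_corner s : C0 (f0 *m td_word true s *m f0).
Proof.
have [N] := ubnP (size s); elim: N s => // N IHN s /ltnSE sN.
have Clin := gensub_lin td_corner_gen.
have short s1 : (size s1 < size s)%N -> C0 (f0 *m td_word true s1 *m f0).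
  by move=> s1s; apply: IHN; apply: leq_trans sN.
have gen Q : C0 (f0 *m ev true Q *m f0) by apply: gensub_gen; exists Q.
(* Some letter Q has size at most k. The outer induction lowers k, the inner one shortens the suffix
   [s2]; shorter words are settled by [IHN]. *)
have step k : forall s1 Q s2, size (s1 ++ Q :: s2) = size s ->
    (size Q <= k)%N -> C0 (f0 *m td_word true (s1 ++ Q :: s2) *m f0).
  elim: k => [|k IHk] s1 Q s2.
    rewrite leqn0 size_poly_eq0 => _ /eqP->.
    rewrite td_word_cat /= spev0 mul0mx !(mulmx0, mul0mx).
    by case: Clin.
  elim: s2 s1 Q => [|R s2 IHs2] s1 Q ss sQ.
    case/lastP: s1 ss => [_|s1 P ss] /=.
      by rewrite td_ev1r.
    (* If the last letter Q belongs to the family of [f0], it acts on [f0] as a scalar and drops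
       out. Otherwise [td_peel] applies to its left neighbour. *)
    have [odd_s1|ev_s1] := boolP (odd (size s1)); last first.
      rewrite td_word_cat /= size_rcons /= (negPf ev_s1) /= td_ev1r.
      rewrite -!mulmxA (mul_spev_idem (td_spectral td false)) -!scalemxAr mulmxA.
      apply: lin_closedZ => //; apply: short.
      by rewrite -ss size_cat /= addn1.
    have eW R : f0 *m td_word true (s1 ++ [:: R; Q]) *m f0 =
        f0 *m td_word true s1 *m (ev false R *m ev true Q *m f0).
      by rewrite td_word_cat /= odd_s1 /= td_ev1r !mulmxA.
    have [c [P' [sP' eP']]] := td_peel P sQ.
    move: ss; rewrite -cats1 -catA /= eW eP' mulmxDr => ss.
    apply: lin_closedD => //; last by rewrite -eW; apply: IHk; rewrite // -ss !size_cat.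
    have -> : f0 *m td_word true s1 *m (c *: (f0 *m ev true Q *m f0)) =
        c *: ((f0 *m td_word true s1 *m f0) *m (f0 *m ev true Q *m f0)).
      by rewrite -scalemxAr !mulmxA -(mulmxA _ f0 f0) f0f0.
    apply: lin_closedZ => //; apply: gensub_mul => //; apply: short.
    by rewrite -ss size_cat /= addn2.
  (* If Q is the first letter, the transpose of [td_peel] lowers its right neighbour R or splits the
     word. *)
  case/lastP: s1 ss => [ss|s1 P ss].
    have eW P : f0 *m td_word true [:: Q, P & s2] *m f0 =
        (ev false P *m ev true Q *m f0)^T *m td_word true s2 *m f0.
      by rewrite !trmx_mul !(spev_tr (td_spectral td _)) gsym /= !mulmxA.
    have [c [P' [sP' eP']]] := td_peel R sQ.
    rewrite [[::] ++ _]/= eW eP' linearD /= !mulmxDl.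
    apply: lin_closedD => //; last first.
      by rewrite -eW; apply: (IHk [:: Q] P' s2).
    rewrite linearZ /= (td_corner_gen_sym (ex_intro _ Q _)) //.
    have -> : c *: (f0 *m ev true Q *m f0) *m td_word true s2 *m f0 =
        c *: ((f0 *m ev true Q *m f0) *m (f0 *m td_word true s2 *m f0)).
      by rewrite -!scalemxAl !mulmxA -(mulmxA _ f0 f0) f0f0.
    apply: lin_closedZ => //; apply: gensub_mul => //; apply: short.
    by rewrite -ss /=.
  rewrite -cats1 -catA /= td_word_split.
  set b := true (+) _.
  set W1 := td_word _ _; set W2 := td_word _ _.
  (* Q now has neighbours on both sides, and [banded_span] trades them for other pairs: a left
     letter of size at most k goes to [IHk], a right letter of size at most k + 1 takes over the
     role of Q in [IHs2]. *)
  pose S : set 'M[F]_n := fun M => C0 (f0 *m (W1 *m M *m W2) *m f0).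
  have Slin : lin_closed S.
    split; rewrite /S; first by rewrite !(mulmx0, mul0mx); case: Clin.
    move=> a B D SB SD; rewrite mulmxDr !mulmxDl mulmxDr mulmxDl.
    rewrite -!(scalemxAl, scalemxAr).
    by case: Clin => _; apply.
  apply: (banded_span (td_spectral td b) (k := k) _ Slin).
    move=> i j far; apply: td_band; case/orP: far => far; apply/orP.
      by left; rewrite (leq_trans _ far) // -addnS leq_add2l.
    by right; rewrite (leq_trans _ far) // -addnS leq_add2l.
  move=> P' R' /orP[sP'|sR']; rewrite /S -td_word_split.
    by apply: IHk => //; move: ss; rewrite !size_cat size_rcons /= !addnS.
  rewrite -cat1s -[Q :: _]cat1s !catA; apply: IHs2 => //.
  by move: ss; rewrite !size_cat size_rcons /= !addnS !addn0.
case: s {sN} short step => [|Q s] short step.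
  by rewrite /= td_idem1r f0f0; have := gen 1; rewrite td_idem1r f0f0.
exact: (step (size Q) [::]).
Qed.

(* Words span the algebra; this impredicative span avoids naming
   coefficients. *)
Definition td_span (M : 'M[F]_n) : Prop :=
  forall S : set 'M[F]_n, lin_closed S -> (forall s, S (td_word true s)) -> S M.

Lemma td_corner_symmetric M : td_span M -> (f0 *m M *m f0)^T = f0 *m M *m f0.
Proof.
move=> spM.
apply: (gensub_symmetric td_corner_gen_comm td_corner_gen_sym).
apply: (spM (fun M => C0 (f0 *m M *m f0))); last exact: td_word_corner.
have Clin := gensub_lin td_corner_gen.
split; first by rewrite mulmx0 mul0mx; case: Clin.
move=> a B D SB SD; rewrite mulmxDr mulmxDl -scalemxAr -scalemxAl.
by case: Clin => _; apply.
Qed.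

Lemma td_span_lin : lin_closed td_span.
Proof.
split=> [S [S0 _] _ //|a B D spB spD S Slin SW].
by case: (Slin) => _; apply; [apply: spB | apply: spD].
Qed.

Lemma td_span_ev b P : td_span (ev b P).
Proof.
move=> S _ SW; case: b; first by have := SW [:: P]; rewrite /= td_ev1r.
by have := SW [:: 1; P]; rewrite /= td_ev1r td_ev1l.
Qed.

Lemma td_span_mul M N : td_span M -> td_span N -> td_span (M *m N).
Proof.
move=> spM spN S [S0 SD] SW; apply: (spM (fun M => S (M *m N))) => [|s].
  split=> [|a B D SB SD']; first by rewrite mul0mx.
  by rewrite mulmxDl -scalemxAl; apply: SD.
apply: (spN (fun N => S (td_word true s *m N))) => [|t].
  split=> [|a B D SB SD']; first by rewrite mulmx0.
  by rewrite mulmxDr -scalemxAr; apply: SD.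
(* After an odd word a letter 1 restores the alternation of the families. *)
have [odd_s|even_s] := boolP (odd (size s)).
  by have := SW (s ++ 1 :: t); rewrite td_word_cat odd_s /= td_word1l.
by have := SW (s ++ t); rewrite td_word_cat (negPf even_s).
Qed.

End TridiagonalSystem.

(** The system of the graph is built over an ordered field, where sums of squares can be used, and
    then carried to the field of scalars. *)
Lemma tridiagonal_system_map (F F' : fieldType) (n m : nat)
    (phi : {rmorphism F -> F'}) (g : bool -> 'I_m -> 'M[F]_n)
    (th : bool -> 'I_m -> F) :
  tridiagonal_system g th ->
  tridiagonal_system (fun b i => map_mx phi (g b i)) (fun b i => phi (th b i)).
Proof.
case=> sp sum tri; split=> [b||b i j ij].
- have [inj gsym gM] := sp b; split=> [i j /fmorph_inj/inj //|i|i j].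
    by rewrite map_trmx gsym.
  by rewrite -map_mxM gM; case: ifP => // _; rewrite raddf0.
- by rewrite -!raddf_sum sum.
- suff -> : spev (fun i => map_mx phi (g (~~ b) i)) (fun i => phi (th (~~ b) i)) 'X
      = map_mx phi (spev (g (~~ b)) (th (~~ b)) 'X).
    by rewrite -!map_mxM tri // raddf0.
  by rewrite raddf_sum; apply: eq_bigr => l _; rewrite !hornerX /= map_mxZ.
Qed.

(** * Exchange and reversal of the two families *)

Section Variants.
Variables (F : fieldType) (n m : nat).
Variables (g : bool -> 'I_m -> 'M[F]_n) (th : bool -> 'I_m -> F).
Variables (c : bool) (rv : bool -> bool).

(* Exchanging the families and reversing their orders puts any of the idempotents
   E_1^*, E_1, E_D^*, E_D at the initial place of the [false] family. *)
Definition variant (T : Type) (h : bool -> 'I_m -> T) b (i : 'I_m) : T :=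
  h (c (+) b) (if rv b then rev_ord i else i).

Lemma spev_variant b P :
  spev (variant g b) (variant th b) P = spev (g (c (+) b)) (th (c (+) b)) P.
Proof.
rewrite /variant; case: (rv b) => //.
by rewrite [RHS](reindex_inj rev_ord_inj).
Qed.

Lemma tridiagonal_system_variant :
  tridiagonal_system g th -> tridiagonal_system (variant g) (variant th).
Proof.
move=> td; split=> [b||b i j ij].
- have [inj gsym gM] := td_spectral td (c (+) b).
  have s_inj : injective (fun i : 'I_m => if rv b then rev_ord i else i).
    by case: (rv b) => //; apply: rev_ord_inj.
  split=> [i j /inj/s_inj //|i|i j]; first exact: gsym.
  by rewrite gM (inj_eq s_inj).
- have E b : \sum_i variant g b i = spev (g (c (+) b)) (th (c (+) b)) 1.
    by rewrite -spev_variant spev1.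
  by rewrite !E; apply: td_ev1.
(* Reversal turns one alternative of [td_band] into the other. *)
- rewrite spev_variant addbN; apply: (td_band td); rewrite size_polyX addn2.
  case: (rv b); last by rewrite ij.
  apply/orP; right; rewrite /= addn2 leq_subRL //.
  by rewrite !addnS -!addSn -[leqRHS](subnKC (ltn_ord j)) leq_add2r.
Qed.

End Variants.

(** * Distance-regular graphs *)

Section Distance.
Local Open Scope nat_scope.
Variables (X : finType) (e : rel X).
Hypothesis (e_sym : symmetric e) (e_irr : irreflexive e).
Hypothesis e_conn : forall y z : X, connect e y z.
Implicit Types x y z : X.

Notation gd := (gdist e).
Notation D := (diameter e).

Lemma walkP k y z :
  reflect (exists p, [/\ size p = k, path e y p & last y p = z]) (walk e k y z).
Proof.
apply: (iffP existsP) => [[p /andP[yp /eqP pz]]|[p [sp yp pz]]].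
  by exists p; rewrite size_tuple.
by exists (tcast sp (in_tuple p)); rewrite val_tcast /= yp pz /=.
Qed.

Lemma gdist_walk y z : walk e (gd y z) y z.
Proof.
have has_w : has (fun k => walk e k y z) (iota 0 #|X|).
  (* A path without repeated vertices has length below [#|X|], inside the search range of
     [gdist]. *)
  case/connectP: (e_conn y z) => p yp ->; case/shortenP: yp => p' yp' p'_uniq _.
  apply/hasP; exists (size p'); last by apply/walkP; exists p'.
  rewrite mem_iota add0n /=.
  by have := max_card [in y :: p']; rewrite (card_uniqP p'_uniq).
have := nth_find 0 has_w; rewrite nth_iota ?add0n //.
by move: has_w; rewrite has_find size_iota.
Qed.

Lemma gdist_min k y z : walk e k y z -> (gd y z <= k).
Proof.
move=> w; rewrite leqNgt; apply/negP => k_lt.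
have k_ltX : (k < #|X|).
  by apply: leq_trans k_lt _; rewrite -(size_iota 0 #|X|) find_size.
have := before_find 0 k_lt.
by rewrite nth_iota ?add0n // w.
Qed.

Lemma gdistxx y : gd y y = 0.
Proof. by apply/eqP; rewrite -leqn0; apply: gdist_min; apply/walkP; exists [::]. Qed.

Lemma gdist0P y z : reflect (y = z) (gd y z == 0).
Proof.
apply: (iffP eqP) => [yz|->]; last exact: gdistxx.
by have := gdist_walk y z; rewrite yz => /walkP[[|? ?] []].
Qed.

Lemma gdist_step x y z : e y z -> (gd x z <= (gd x y).+1).
Proof.
move=> yz; case/walkP: (gdist_walk x y) => p [sp xp py].
apply: gdist_min; apply/walkP; exists (rcons p z).
by rewrite size_rcons sp rcons_path xp py yz last_rcons.
Qed.

Lemma gdist_sym y z : gd y z = gd z y.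
Proof.
suff le u v : (gd u v <= gd v u) by apply/eqP; rewrite eqn_leq !le.
case/walkP: (gdist_walk v u) => p [sp vp pu]; apply: gdist_min; apply/walkP.
exists (rev (belast v p)); split; first by rewrite size_rev size_belast.
  by rewrite -pu rev_path (eq_path (e' := e)) // => ? ?; apply: e_sym.
by case: p sp vp pu => [|w p] //= _ _ _; rewrite rev_cons last_rcons.
Qed.

Lemma gdist1 y z : (gd y z == 1) = e y z.
Proof.
apply/eqP/idP => [yz|yz].
  have := gdist_walk y z; rewrite yz => /walkP[[|w [|? ?]] []] //= _.
  by rewrite andbT => yw <-.
apply/eqP; rewrite eqn_leq -{1}(gdistxx y) gdist_step // lt0n.
by apply/gdist0P => E; rewrite E e_irr in yz.
Qed.

Lemma gdist_diam y z : (gd y z <= D).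
Proof.
apply: leq_trans (leq_bigmax y).
exact: (leq_bigmax (F := fun z => gd y z)).
Qed.

Lemma gdist_pred x z k : gd x z = k.+1 -> exists2 y, gd x y = k & e y z.
Proof.
move=> xz; case/walkP: (gdist_walk x z); rewrite xz => p [].
case/lastP: p => // p w; rewrite size_rcons rcons_path last_rcons.
move=> [sp] /andP[xp yw] wz; rewrite wz in yw.
exists (last x p) => //; apply/eqP; rewrite eqn_leq; apply/andP; split.
  by apply: gdist_min; apply/walkP; exists p.
by rewrite -ltnS -xz gdist_step.
Qed.

(** Start from a pair at distance D and step back along a shortest path. *)
Lemma gdist_sphere x0 k : (k <= D) -> exists x z, gd x z = k.
Proof.
move=> kD.
have X_gt0 : (0 < #|X|) by apply/card_gt0P; exists x0.
have [x Dx] := @bigop.eq_bigmax X (fun y => \max_z gd y z) X_gt0.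
have [z xz] := @bigop.eq_bigmax X (fun z => gd x z) X_gt0.
exists x; move: kD; rewrite /diameter Dx xz.
move E: (gd x z) => h; elim: h z E {xz}.
  by move=> y y0; rewrite leqn0 => /eqP->; exists y.
move=> h IH y yh; rewrite leq_eqVlt => /predU1P[->|]; first by exists y.
by have [w wh _] := gdist_pred yh; apply: IH wh.
Qed.

Hypothesis e_dr : distance_regular e.

(** The size of a sphere is an intersection number with upper index 0, the same at all vertices, so
    one pair at distance k suffices. *)
Lemma sphere_neq0 x k : (k <= D) -> exists z, gd x z = k.
Proof.
move=> kD; have [y [z yz]] := gdist_sphere x kD; have [p p_eq] := e_dr.
have pkk : (p 0 k k > 0).
  rewrite -(p_eq 0 k k _ kD kD y y (gdistxx y)) //; apply/card_gt0P; exists z.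
  by rewrite inE yz eqxx.
move: pkk; rewrite -(p_eq 0 k k _ kD kD x x (gdistxx x)) // => /card_gt0P [w].
by rewrite inE => /andP[/eqP xw _]; exists w.
Qed.

End Distance.

(** * Polynomials in a matrix and its primitive idempotents *)

Definition power_closed (F : fieldType) (n : nat) (A : 'M[F]_n)
    (S : set 'M[F]_n) : Prop :=
  [/\ lin_closed S, S 1%:M & forall B, S B -> S (A *m B)].

Lemma mulmx_tr_eq0 (R : realFieldType) k (u : 'rV[R]_k) : u *m u^T = 0 -> u = 0.
Proof.
move=> /matrixP/(_ 0 0); rewrite !mxE => u0; apply/rowP => i; rewrite mxE.
move/eqP: u0; rewrite psumr_eq0 => [|j _]; last first.
  by rewrite mxE -expr2 sqr_ge0.
move/allP/(_ i (mem_index_enum _)); rewrite mxE /= -expr2 sqrf_eq0.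
by move/eqP.
Qed.

Section PolynomialsInMatrix.
Variables (F : fieldType) (n m : nat) (A : 'M[F]_n.+1).
Variables (theta : 'I_m.+1 -> F).
Hypothesis theta_inj : injective theta.
Hypothesis theta_eig : forall i, eigenvalue A (theta i).

(** Properties of polynomials in A, and through them of the idempotents, are obtained by exhibiting
    a power-closed set. *)
Lemma horner_mx_power_closed (S : set 'M[F]_n.+1) P :
  power_closed A S -> S (horner_mx A P).
Proof.
case=> Slin S1 SA; elim/poly_ind: P => [|P c SP].
  by rewrite rmorph0; case: Slin.
rewrite rmorphD mulrC rmorphM /= horner_mx_X horner_mx_C.
rewrite -[c%:M]scalemx1 addrC; case: (Slin) => _; apply=> //.
exact: SA.
Qed.

Lemma eigenvector_horner_mx a (w : 'rV[F]_n.+1) P :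
  w *m A = a *: w -> w *m horner_mx A P = P.[a] *: w.
Proof.
move=> wA; elim/poly_ind: P => [|P c IH]; first by rewrite rmorph0 horner0 mulmx0 scale0r.
rewrite rmorphD rmorphM /= horner_mx_X horner_mx_C mulmxDr mulmxA IH -scalemxAl wA.
by rewrite mul_mx_scalar scalerA !hornerE scalerDl.
Qed.

(** The first m + 2 powers of A lie in a span of m + 1 matrices, so a nonzero P of degree at most m
    + 1 kills A. The m + 1 eigenvalues are roots of P, hence P is a scalar multiple of the
    product. *)
Lemma annihilator (B : 'I_m.+1 -> 'M[F]_n.+1) :
  (forall k, exists c : 'rV[F]_m.+1, A ^+ k = \sum_h c 0 h *: B h) ->
  horner_mx A (\prod_i ('X - (theta i)%:P)) = 0.
Proof.
move=> AB; pose th := codom theta.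
have th_uniq : uniq th by apply/injectiveP.
have size_th : size th = m.+1 by rewrite size_codom card_ord.
have [C C_eq] : exists C : 'I_m.+2 -> 'rV[F]_m.+1,
    forall k : 'I_m.+2, A ^+ k = \sum_h C k 0 h *: B h.
  exact: (fin_all_exists (fun k : 'I_m.+2 => AB k)).
pose M := \matrix_(k < m.+2) C k.
have : kermx M != 0.
  rewrite kermx_eq0; apply/negP => /eqP rkM.
  by have := rank_leq_col M; rewrite rkM ltnn.
rewrite -nz_row_eq0; set v := nz_row _ => v0.
have vM : v *m M = 0 by apply/sub_kermxP; apply: nz_row_sub.
pose P := rVpoly v.
have P0 : P != 0.
  by apply: contraNneq v0 => P0; rewrite -[v]rVpolyK -/P P0 linear0.
have PA : horner_mx A P = 0.
  rewrite horner_rVpoly; suff -> : powers_mx A m.+2 = M *m \matrix_h mxvec (B h).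
    by rewrite mulmxA vM mul0mx linear0.
  apply/row_matrixP => k; rewrite row_mul !rowK C_eq mulmx_sum_row linear_sum.
  by apply: eq_bigr => h _; rewrite linearZ rowK.
have P_root : all (root P) th.
  apply/allP => _ /codomP[i ->]; have /eigenvalueP[w wA w0] := theta_eig i.
  have := eigenvector_horner_mx P wA; rewrite PA mulmx0 => /esym/eqP.
  by rewrite scaler_eq0 (negPf w0) orbF.
have sP : size P = (size th).+1.
  apply/eqP; rewrite eqn_leq size_th (leq_trans (size_poly _ _)) //=.
  by rewrite -size_th max_poly_roots.
have P_eq : P = lead_coef P *: \prod_i ('X - (theta i)%:P).
  rewrite {1}(all_roots_prod_XsubC sP P_root) ?uniq_rootsE //.
  by rewrite /th big_map big_enum.
move: PA; rewrite P_eq linearZ /= => /eqP; rewrite scaler_eq0 lead_coef_eq0 (negPf P0).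
by move/eqP.
Qed.

End PolynomialsInMatrix.

(** Each [E i] is the Lagrange polynomial [L i] evaluated at A. The set S and its spanning family B
    only supply the annihilating polynomial. *)
Lemma primitive_idempotents_decomp (R : realFieldType) (n m : nat)
    (A : 'M[R]_n) (theta : 'I_m.+1 -> R) (E : 'I_m.+1 -> 'M[R]_n)
    (S : set 'M[R]_n) (B : 'I_m.+1 -> 'M[R]_n) :
  A^T = A -> injective theta -> (forall i, eigenvalue A (theta i)) ->
  (forall i, orthogonal_projection (E i) (eigenspace A (theta i))) ->
  power_closed A S ->
  (forall M, S M -> exists c : 'rV[R]_m.+1, M = \sum_h c 0 h *: B h) ->
  [/\ \sum_i E i = 1%:M, forall i, A *m E i = theta i *: E i &
      forall S', power_closed A S' -> forall i, S' (E i)].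
Proof.
case: n A E S B => [|n] A E S B A_sym th_inj eig E_proj S_closed S_dim.
  (* In size 0 there is no nonzero vector, hence no eigenvalue. *)
  have /eigenvalueP[v _] := eig ord0.
  by rewrite [v]thinmx0 eqxx.
pose M i := \prod_(j in predC1 i) ('X - (theta j)%:P).
pose L i := (M i).[theta i]^-1 *: M i.
have Mi i : (M i).[theta i] != 0.
  rewrite horner_prod; apply/prodf_neq0 => j; rewrite inE => ji.
  by rewrite hornerXsubC subr_eq0 (inj_eq th_inj) eq_sym.
have sM i : (size (M i) <= m.+1)%N.
  by rewrite /M -big_enum size_prod_XsubC -cardE cardC1 card_ord.
have LL i j : (L i).[theta j] = (i == j)%:R.
  rewrite hornerZ; have [<-|ij] := eqVneq i j; first by rewrite mulVf.
  have ji : j \in predC1 i by rewrite inE eq_sym.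
  suff -> : (M i).[theta j] = 0 by rewrite mulr0.
  by rewrite /M horner_prod (bigD1 j) //= hornerXsubC subrr mul0r.
have sumL : \sum_i L i = 1.
  apply/eqP; rewrite -subr_eq0; apply/eqP.
  apply: (@roots_geq_poly_eq0 _ _ (codom theta)).
  - apply/allP => _ /codomP[j ->]; rewrite rootE hornerD hornerN horner_sum.
    rewrite (bigD1 j) //= LL eqxx big1 => [|i ij]; last by rewrite LL (negPf ij).
    by rewrite addr0 hornerE subrr.
  - exact/injectiveP.
  - rewrite size_codom card_ord; apply: leq_trans (size_polyD _ _) _.
    rewrite size_polyN size_poly1 geq_max andbT.
    apply: leq_trans (size_sum _ _ _) _; apply/bigmax_leqP => i _.
    exact: leq_trans (size_scale_leq _ _) (sM i).
have ann : horner_mx A (\prod_i ('X - (theta i)%:P)) = 0.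
  apply: (annihilator th_inj eig (B := B)) => k; apply: S_dim.
  by rewrite -(horner_mx_X A) -rmorphXn; apply: horner_mx_power_closed.
have AL i : A *m horner_mx A (L i) = theta i *: horner_mx A (L i).
  rewrite -{1}[A]horner_mx_X -[_ *m _](rmorphM (horner_mx A)) /=.
  apply/eqP; rewrite -subr_eq0 -linearZ -raddfB /= -mul_polyC -mulrBl.
  rewrite -scalerAr linearZ /= -[X in _ *: X](_ : 0 = _) ?scaler0 // -ann.
  by rewrite (bigD1 i).
have A_closed : power_closed A (fun M => M^T = M /\ A *m M = M *m A).
  split=> [||B' [B'_sym AB']].
  - split=> [|a B1 B2 [B1s B1A] [B2s B2A]]; first by rewrite trmx0 mulmx0 mul0mx.
    rewrite linearD linearZ /= B1s B2s; split=> //.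
    by rewrite mulmxDr mulmxDl -scalemxAr -scalemxAl B1A B2A.
  - by rewrite trmx1 mulmx1 mul1mx; split.
  - by split; [rewrite trmx_mul B'_sym A_sym | rewrite {1}AB' mulmxA].
(* For each basis row v the difference u of the two images lies in the eigenspace. Both
   [v - v *m E i] and [v - v *m horner_mx A (L i)] are orthogonal to u, so [u *m u^T] is zero. *)
have EL i : E i = horner_mx A (L i).
  have [L_sym _] := horner_mx_power_closed (L i) A_closed.
  apply/row_matrixP => j; rewrite !rowE; set v := delta_mx _ _.
  have [/eigenspaceP vE vE_orth] := E_proj i v.
  have vL : v *m horner_mx A (L i) *m A = theta i *: (v *m horner_mx A (L i)).
    have [_ LA] := horner_mx_power_closed (L i) A_closed.
    by rewrite -mulmxA -LA AL -scalemxAr.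
  set u := v *m E i - v *m horner_mx A (L i).
  have uA : u *m A = theta i *: u by rewrite mulmxBl vE vL scalerBr.
  have uL : u *m horner_mx A (L i) = u.
    by rewrite (eigenvector_horner_mx _ uA) LL eqxx scale1r.
  apply/eqP; rewrite -subr_eq0 -/u; apply/eqP/mulmx_tr_eq0.
  have uE : u = (v - v *m horner_mx A (L i)) - (v - v *m E i).
    by rewrite opprB addrC addrA subrK.
  rewrite {1}uE mulmxBl vE_orth ?subr0; last exact/eigenspaceP.
  by rewrite mulmxBl -mulmxA -L_sym -trmx_mul uL subrr.
split=> [|i|S' S'_closed i].
- under eq_bigr do rewrite EL.
  by rewrite -(linear_sum (horner_mx A)) sumL rmorph1.
- by rewrite EL AL.
- by rewrite EL; apply: horner_mx_power_closed.
Qed.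

(** * The Bose-Mesner algebra *)

Section BoseMesner.
Variables (X : finType) (e : rel X).
Hypothesis (e_sym : symmetric e) (e_irr : irreflexive e).
Hypothesis e_conn : forall y z : X, connect e y z.
Hypothesis e_dr : distance_regular e.

Notation n := #|X|.
Notation D := (diameter e).

Definition vdist (j k : 'I_n) : nat := gdist e (enum_val j) (enum_val k).

Lemma vdist_sym j k : vdist j k = vdist k j.
Proof. exact: gdist_sym. Qed.

Lemma vdist_diam j k : (vdist j k <= D)%N.
Proof. exact: gdist_diam. Qed.

Lemma vdist_eq0 j k : (vdist j k == 0%N) = (j == k).
Proof. by rewrite -(inj_eq enum_val_inj); apply/(gdist0P e_conn)/eqP. Qed.

Lemma intersection_numbers : exists p : nat -> nat -> nat -> nat,
  forall a b j k, (a <= D)%N -> (b <= D)%N ->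
  (\sum_w ((vdist j w == a) && (vdist w k == b)) = p (vdist j k) a b)%N.
Proof.
have [p p_eq] := e_dr; exists p => a b j k aD bD.
rewrite -(p_eq _ a b (vdist_diam j k) aD bD (enum_val j) (enum_val k)) //.
rewrite -[RHS]sum1_card (reindex (@enum_val X predT)) /=; last first.
  exact/onW_bij/enum_val_bij.
rewrite [RHS]big_mkcond /=; apply: eq_bigr => w _; rewrite inE.
by rewrite (vdist_sym w k) /vdist; case: (_ && _).
Qed.

Section Ring.
Variable F : fieldType.

(** This is the Bose-Mesner algebra, the span of the distance matrices. *)
Definition distance_constant : set 'M[F]_n :=
  fun M => exists c : nat -> F, forall j k, M j k = c (vdist j k).

Definition dist_mx (h : nat) : 'M[F]_n := \matrix_(j, k) (vdist j k == h)%:R.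

Lemma adj_mxE : adj_mx e F = dist_mx 1.
Proof. by apply/matrixP => j k; rewrite !mxE gdist1. Qed.

Lemma adj_mx_sym : (adj_mx e F)^T = adj_mx e F.
Proof. by apply/matrixP => j k; rewrite !mxE e_sym. Qed.

Lemma dist_mx_const h : distance_constant (dist_mx h).
Proof. by exists (fun d => (d == h)%:R) => j k; rewrite mxE. Qed.

Lemma distance_constant_sum M : distance_constant M ->
  exists c : 'rV[F]_D.+1, M = \sum_h c 0 h *: dist_mx h.
Proof.
case=> c Mc; exists (\row_h c h); apply/matrixP => j k.
have dD : (vdist j k < D.+1)%N by rewrite ltnS vdist_diam.
rewrite summxE (bigD1 (Ordinal dD)) //= big1 => [|h hd].
  by rewrite !mxE eqxx mulr1 addr0.
rewrite !mxE (_ : _ == _ = false) ?mulr0 //; apply: contraNF hd => /eqP hd.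
by apply/eqP/ord_inj.
Qed.

Lemma distance_constant_lin : lin_closed distance_constant.
Proof.
split=> [|a B C [b Bb] [c Cc]]; first by exists (fun=> 0) => j k; rewrite mxE.
by exists (fun d => a * b d + c d) => j k; rewrite !mxE Bb Cc.
Qed.

Lemma distance_constant1 : distance_constant 1%:M.
Proof.
by exists (fun d => (d == 0%N)%:R) => j k; rewrite mxE vdist_eq0.
Qed.

Lemma distance_constant_mul M N :
  distance_constant M -> distance_constant N -> distance_constant (M *m N).
Proof.
have [p p_eq] := intersection_numbers.
move=> /distance_constant_sum[b ->] /distance_constant_sum[c ->].
rewrite mulmx_suml; apply: (lin_closed_sum _ distance_constant_lin) => h _.
rewrite mulmx_sumr; apply: (lin_closed_sum _ distance_constant_lin) => i _.
rewrite -scalemxAl -scalemxAr.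
do 2!apply: (lin_closedZ _ distance_constant_lin).
exists (fun d => (p d h i)%:R) => j k.
rewrite -p_eq ?leq_ord // natr_sum mxE; apply: eq_bigr => w _.
by rewrite !mxE -natrM mulnb.
Qed.

Lemma distance_constant_power : power_closed (adj_mx e F) distance_constant.
Proof.
split; [exact: distance_constant_lin | exact: distance_constant1|].
by move=> B; apply: distance_constant_mul; rewrite adj_mxE; apply: dist_mx_const.
Qed.

End Ring.

Variable R : realFieldType.
Variable theta : 'I_D.+1 -> R.
Hypothesis theta_eig : eigenvalue_ordering theta.
Variable E : 'I_D.+1 -> 'M[R]_n.
Hypothesis E_idem : primitive_idempotents theta E.

Notation A := (adj_mx e R).

Let theta_inj : injective theta. Proof. by case: theta_eig. Qed.

Let decomp : [/\ \sum_i E i = 1%:M, forall i, A *m E i = theta i *: E i &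
  forall S', power_closed A S' -> forall i, S' (E i)].
Proof.
apply: primitive_idempotents_decomp E_idem (distance_constant_power R)
  (@distance_constant_sum R) => //; first exact: adj_mx_sym.
by move=> i; case: theta_eig => _ eig _; apply/eig; exists i.
Qed.

Lemma idem_sum1 : \sum_i E i = 1%:M. Proof. by case: decomp. Qed.

Lemma adj_mul_idem i : A *m E i = theta i *: E i.
Proof. by case: decomp. Qed.

Lemma idem_closed S : power_closed A S -> forall i, S (E i).
Proof. by case: decomp => _ _; apply. Qed.

Lemma idem_sym_comm i : (E i)^T = E i /\ A *m E i = E i *m A.
Proof.
apply: (@idem_closed (fun M => M^T = M /\ A *m M = M *m A)).
split=> [||B [B_sym AB]].
- split=> [|a B C [Bs AB] [Cs AC]]; first by rewrite trmx0 mulmx0 mul0mx.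
  rewrite linearD linearZ /= Bs Cs; split=> //.
  by rewrite mulmxDr mulmxDl -scalemxAr -scalemxAl AB AC.
- by rewrite trmx1 mulmx1 mul1mx; split.
- by split; [rewrite trmx_mul B_sym adj_mx_sym | rewrite {1}AB mulmxA].
Qed.

Lemma idem_sym i : (E i)^T = E i. Proof. by case: (idem_sym_comm i). Qed.

Lemma idem_mul_adj i : E i *m A = theta i *: E i.
Proof. by case: (idem_sym_comm i) => _ <-; apply: adj_mul_idem. Qed.

Lemma idem_mul i j : E i *m E j = if i == j then E i else 0.
Proof.
have orth k l : k != l -> E k *m E l = 0.
  move=> kl; apply/eqP; have : (theta k - theta l) *: (E k *m E l) == 0.
    rewrite scalerBl {1}scalemxAl -idem_mul_adj scalemxAr -adj_mul_idem.
    by rewrite mulmxA subrr.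
  by rewrite scaler_eq0 subr_eq0 (inj_eq theta_inj) (negPf kl).
have [<-|/orth//] := eqVneq i j.
rewrite -[RHS]mulmx1 -idem_sum1 mulmx_sumr (bigD1 i) //= big1 ?addr0 //.
by move=> k ki; apply: orth; rewrite eq_sym.
Qed.

Lemma idem_distance_constant i : distance_constant (E i).
Proof. exact: idem_closed (distance_constant_power R) i. Qed.

Lemma idem_neq0 i : E i != 0.
Proof.
have /eigenvalueP[w wA w0] : eigenvalue A (theta i).
  by case: theta_eig => _ eig _; apply/eig; exists i.
suff wE : w *m E i = w by apply: contraNneq w0 => E0; rewrite -wE E0 mulmx0.
rewrite -[RHS]mulmx1 -idem_sum1 mulmx_sumr [RHS](bigD1 i) //= big1 ?addr0 //.
move=> j ji; apply/eqP; have : (theta i - theta j) *: (w *m E j) == 0.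
  rewrite scalerBl {1}scalemxAl -wA scalemxAr -adj_mul_idem.
  by rewrite mulmxA subrr.
by rewrite scaler_eq0 subr_eq0 (inj_eq theta_inj) eq_sym (negPf ji).
Qed.

(** The D + 1 independent idempotents lie in the span of the D + 1 distance matrices, so the square
    transition matrix Q is invertible. *)
Lemma distance_constant_idem M : distance_constant M ->
  exists c : 'I_D.+1 -> R, M = \sum_i c i *: E i.
Proof.
move=> Mdc.
have [q q_eq] : exists q : 'I_D.+1 -> 'rV[R]_D.+1,
    forall i, E i = \sum_h q i 0 h *: dist_mx R h.
  apply: (fin_all_exists (fun i => distance_constant_sum _)).
  exact: idem_distance_constant.
pose Q := \matrix_i q i.
have EQ (c : 'rV_D.+1) :
    \sum_i c 0 i *: E i = \sum_h (c *m Q) 0 h *: dist_mx R h.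
  under eq_bigr do rewrite q_eq scaler_sumr.
  rewrite exchange_big; apply: eq_bigr => h _.
  rewrite mxE scaler_suml; apply: eq_bigr => i _.
  by rewrite scalerA !mxE.
have Q_unit : Q \in unitmx.
  rewrite -row_free_unit; apply: inj_row_free => v vQ.
  apply/rowP => i; rewrite mxE; apply/eqP; move: (idem_neq0 i).
  apply: contraNT => vi; have : (\sum_j v 0 j *: E j) *m E i = 0.
    by rewrite EQ vQ big1 ?mul0mx // => h _; rewrite mxE scale0r.
  rewrite mulmx_suml (bigD1 i) //= -scalemxAl idem_mul eqxx big1 ?addr0.
    by move/eqP; rewrite scaler_eq0 (negPf vi).
  by move=> j ji; rewrite -scalemxAl idem_mul (negPf ji) scaler0.
have [b Mb] := distance_constant_sum Mdc.
by exists (fun i => (b *m invmx Q) 0 i); rewrite EQ mulmxKV.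
Qed.

Lemma distance_constant_mul_idem M i : distance_constant M ->
  exists a, M *m E i = a *: E i.
Proof.
case/distance_constant_idem=> c ->; exists (c i).
rewrite mulmx_suml (bigD1 i) //= -scalemxAl idem_mul eqxx big1 ?addr0 // => j ji.
by rewrite -scalemxAl idem_mul (negPf ji) scaler0.
Qed.

(** The all-ones matrix lies in the Bose-Mesner algebra and its columns are eigenvectors for the
    valency [theta ord0], so only [E ord0] occurs in its expansion. *)
Lemma idem0 (x : X) : exists a, E ord0 = a *: const_mx 1.
Proof.
have Jdc : distance_constant (const_mx 1 : 'M[R]_n).
  by exists (fun=> 1) => j k; rewrite mxE.
have [c Jc] := distance_constant_idem Jdc.
have AJ : A *m const_mx 1 = theta ord0 *: (const_mx 1 : 'M[R]_n).
  apply/matrixP => j k; rewrite !mxE mulr1.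
  have [_ _ /(_ (enum_val j)) ->] := theta_eig.
  rewrite -(sum1_card [pred z | e (enum_val j) z]).
  rewrite (reindex (@enum_val X predT)) /=; last first.
    exact/onW_bij/enum_val_bij.
  rewrite [X in X%:R]big_mkcond natr_sum; apply: eq_bigr => w _.
  by rewrite !mxE mulr1 inE; case: e.
have cE i : i != ord0 -> c i = 0.
  move=> i0; apply/eqP; move: (idem_neq0 i).
  apply: contraNT => ci; have EJ : E i *m const_mx 1 = c i *: E i.
    rewrite Jc mulmx_sumr (bigD1 i) //= -scalemxAr idem_mul eqxx big1 ?addr0 //.
    by move=> j ji; rewrite -scalemxAr idem_mul eq_sym (negPf ji) scaler0.
  have : (theta i - theta ord0) *: (c i *: E i) == 0.
    rewrite scalerBl -EJ {1}scalemxAl -idem_mul_adj -mulmxA AJ.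
    by rewrite -scalemxAr subrr.
  by rewrite !scaler_eq0 subr_eq0 (inj_eq theta_inj) (negPf i0) (negPf ci).
exists (c ord0)^-1; rewrite Jc (bigD1 ord0) //= big1 ?addr0.
  rewrite scalerA mulVf ?scale1r //.
  apply/eqP => c0; have /matrixP/(_ (enum_rank x) (enum_rank x)) := Jc.
  rewrite summxE big1 => [|i _]; first by rewrite mxE => /eqP; rewrite oner_eq0.
  have [->|/cE->] := eqVneq i ord0; by rewrite ?c0 scale0r mxE.
by move=> i /cE ->; rewrite scale0r.
Qed.

Lemma idem_entry_sym i j k : E i j k = E i k j.
Proof. by rewrite -{1}idem_sym mxE. Qed.

Lemma mxtrace_mul_tr_eq0 (N : 'M[R]_n) : \tr (N *m N^T) = 0 -> N = 0.
Proof.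
move=> /eqP; rewrite psumr_eq0 => [/allP N0|i _]; last first.
  by rewrite mxE sumr_ge0 // => j _; rewrite mxE -expr2 sqr_ge0.
apply/row_matrixP => i; rewrite row0; apply: mulmx_tr_eq0.
apply/matrixP => a b; rewrite !ord1 [RHS]mxE.
have /eqP := N0 i (mem_index_enum _); apply: etrans.
by rewrite !mxE; apply: eq_bigr => j _; rewrite !mxE.
Qed.

(** * The dual adjacency matrix and the dual idempotents *)

Hypothesis D_gt0 : (0 < D)%N.
Hypothesis E_Qpol : Q_polynomial E.
Variable x : X.

Notation r := (enum_rank x).
Notation d j := (vdist r j).
Let one : 'I_D.+1 := inord 1.

Let one1 : one = 1%N :> nat. Proof. by rewrite inordK. Qed.

Lemma dual_idemE (F : fieldType) i :
  dual_idem e F x i = \matrix_(j, k) ((j == k) && (d j == i))%:R.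
Proof. by apply/matrixP => j k; rewrite !mxE /vdist enum_rankK. Qed.

(** The dual adjacency matrix with respect to x, without the customary factor |X|. *)
Definition dual_adj : 'M[R]_n := diag_mx (row r (E one)).

(** The sum of the squared entries of the product is the (x,x)-entry of $E_1(E_i\circ E_j)E_1$, a
    multiple of the Krein parameter $q^1_{i,j}$, which vanishes for j > i + 1. *)
Lemma dual_adj_band (i j : 'I_D.+1) :
  (i.+1 < j)%N -> E i *m dual_adj *m E j = 0.
Proof.
move=> ij; apply: mxtrace_mul_tr_eq0.
rewrite !trmx_mul !idem_sym tr_diag_mx -/dual_adj !mulmxA mxtrace_mulC !mulmxA.
rewrite idem_mul eqxx -(mulmxA _ (E j) (E j)) idem_mul eqxx.
have [q [q_eq q0]] := E_Qpol.
have qij : q one i j = 0.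
  by have [-> //] := q0 one i j; rewrite one1 add1n ij !orbT.
pose M := map2_mx *%R (E i) (E j).
have -> : \tr (E i *m dual_adj *m E j *m dual_adj) = (E one *m M *m E one) r r.
  rewrite /mxtrace [RHS]mxE; apply: eq_bigr => k _.
  rewrite mul_mx_diag !mxE (idem_entry_sym one k r).
  congr (_ * _); rewrite mul_mx_diag; apply: eq_bigr => l _.
  by rewrite !mxE (idem_entry_sym i k l) mulrCA !mulrA.
rewrite /M q_eq -scalemxAr -scalemxAl mulmx_sumr mulmx_suml big1.
  by rewrite scaler0 mxE.
move=> h _; rewrite -scalemxAr -scalemxAl idem_mul.
by case: eqP => [<-|_]; rewrite ?qij ?scale0r // mul0mx scaler0.
Qed.

(** In the expansion of $E_1\circ E_l$ the idempotent $E_{l+1}$ has a nonzero coefficient and no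
    later one occurs. By induction row x of every [E l] agrees at j and k, hence so does row x of
    every distance matrix. *)
Lemma dual_adj_separates j k : E one r j = E one r k -> d j = d k.
Proof.
move=> E1jk.
have Ejk (l : 'I_D.+1) : E l r j = E l r k.
  have [h] := ubnP l; elim: h l => // h IH [[|l] lD] /ltnSE lh.
    have [a Ea] := idem0 x.
    by rewrite (_ : Ordinal lD = ord0) ?Ea ?mxE //; apply: ord_inj.
  have lD' : (l < D.+1)%N by apply: ltnW.
  have [q [q_eq q0]] := E_Qpol.
  pose l' := Ordinal lD'; pose L := Ordinal lD.
  have := q_eq one l' => /matrixP eq1.
  have : \sum_h q h one l' * E h r j = \sum_h q h one l' * E h r k.
    have n0 : #|X|%:R^-1 != 0 :> R.
      by rewrite invr_eq0 pnatr_eq0 -lt0n; apply/card_gt0P; exists x.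
    apply: (mulfI n0).
    transitivity (E one r j * E l' r j).
      have := eq1 r j; rewrite !mxE summxE => ->; congr (_ * _).
      by apply: eq_bigr => i _; rewrite mxE.
    rewrite E1jk (IH l') //.
    have := eq1 r k; rewrite !mxE summxE => ->; congr (_ * _).
    by apply: eq_bigr => i _; rewrite mxE.
  rewrite (bigD1 L) //= [RHS](bigD1 L) //=.
  have -> : \sum_(i | i != L) q i one l' * E i r j =
            \sum_(i | i != L) q i one l' * E i r k.
    apply: eq_bigr => i iL; have [il|li] := leqP i l.
      by rewrite (IH i) // (leq_ltn_trans il).
    have -> : q i one l' = 0; last by rewrite !mul0r.
    have [-> //] := q0 i one l'.
    rewrite one1 add1n /= [(l.+1 < i)%N]ltn_neqAle li andbT.
    by rewrite eq_sym (contraNneq _ iL) // => iL'; apply/eqP/ord_inj.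
  move/addIr/mulfI; apply.
  by have [_ ->] := q0 L one l'; rewrite // one1 add1n eqxx.
have [c distE] := distance_constant_idem (dist_mx_const R (d j)).
have := distE => /matrixP jk.
have : dist_mx R (d j) r j = dist_mx R (d j) r k.
  by rewrite !jk !summxE; apply: eq_bigr => i _; rewrite !mxE Ejk.
rewrite !mxE eqxx; case: eqP => // _ /eqP; by rewrite oner_eq0.
Qed.

Lemma sphere_nonempty a : (a <= D)%N -> exists j, d j = a.
Proof.
move=> aD; have [z xz] := sphere_neq0 e_conn e_dr x aD.
by exists (enum_rank z); rewrite /vdist !enum_rankK.
Qed.

Lemma dual_adj_eigenvalues : exists ths : 'I_D.+1 -> R,
  injective ths /\ dual_adj = \sum_i ths i *: dual_idem e R x i.
Proof.
have [c Ec] := idem_distance_constant one; exists (fun i => c i); split.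
  move=> i j cij; apply: ord_inj.
  have [a ai] := sphere_nonempty (leq_ord i).
  have [b bj] := sphere_nonempty (leq_ord j).
  by rewrite -ai -bj; apply: dual_adj_separates; rewrite !Ec ai bj.
apply/matrixP => j k; rewrite summxE.
under eq_bigr do rewrite dual_idemE !mxE.
rewrite !mxE Ec; have [->|jk] := eqVneq j k; last first.
  by rewrite big1 // => i _; rewrite mulr0.
have kD : (d k < D.+1)%N by rewrite ltnS vdist_diam.
rewrite (bigD1 (Ordinal kD)) //= eqxx mulr1 big1 ?addr0 ?mulr1n // => i ik.
rewrite (_ : _ == _ = false) ?mulr0 //; apply: contraNF ik => /eqP ik.
by apply/eqP/ord_inj.
Qed.

Lemma dual_idem_mul (F : fieldType) a b :
  dual_idem e F x a *m dual_idem e F x b =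
  if a == b then dual_idem e F x a else 0.
Proof.
apply/matrixP => j k; rewrite !dual_idemE mxE (bigD1 j) //= big1 => [|i ij].
  rewrite !mxE eqxx addr0 /= -natrM mulnb.
  have [<-|ab] := eqVneq a b; rewrite mxE; first by case: (j == k); case: (_ == a).
  case: (j == k) => //=; rewrite ?andbF //.
  by case: (eqVneq (d j) a) => [->|]; rewrite // (negPf ab).
by rewrite !mxE eq_sym (negPf ij) mul0r.
Qed.

Lemma dual_idem_sym (F : fieldType) a : (dual_idem e F x a)^T = dual_idem e F x a.
Proof.
by apply/matrixP => j k; rewrite !mxE eq_sym; case: eqVneq => // ->.
Qed.

Lemma dual_idem_sum1 (F : fieldType) : \sum_(i < D.+1) dual_idem e F x i = 1%:M.
Proof.
apply/matrixP => j k; rewrite summxE mxE.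
have jD : (d j < D.+1)%N by rewrite ltnS vdist_diam.
rewrite (bigD1 (Ordinal jD)) //= dual_idemE mxE eqxx andbT big1 ?addr0 // => i ij.
rewrite dual_idemE mxE (_ : (d j == i) = false) ?andbF //; apply: contraNF ij => /eqP ij.
by apply/eqP/ord_inj.
Qed.

Lemma dual_idem_band (F : fieldType) a b :
  (a.+1 < b)%N -> dual_idem e F x a *m adj_mx e F *m dual_idem e F x b = 0.
Proof.
move=> ab; apply/matrixP => j k; rewrite !dual_idemE mxE big1 ?mxE // => i _.
rewrite !mxE; case: (eqVneq i k) => [->|]; last by rewrite mulr0.
rewrite (bigD1 j) //= big1 => [|l lj]; last by rewrite !mxE eq_sym (negPf lj) mul0r.
rewrite !mxE eqxx addr0 /=; case: (eqVneq (d j) a) => [ja|]; last by rewrite !mul0r.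
case: (eqVneq (d k) b) => [kb|]; last by rewrite mulr0.
have [jk|] := boolP (e _ _); last by rewrite mulr0 mul0r.
have := gdist_step e_conn x jk; rewrite -[x]enum_rankK -/(d j) -/(d k) ja kb.
by rewrite leqNgt ab.
Qed.

(** * The primary module *)

Definition sphere_size a : nat := #|[pred j : 'I_n | d j == a]|.

(* The projection onto the span of the vectors [dual_idem i *m 1], that is, onto
   the primary module of the Terwilliger algebra. *)
Definition primary_proj : 'M[R]_n :=
  \matrix_(j, k) (if d j == d k then (sphere_size (d j))%:R^-1 else 0).

Lemma sphere_size_neq0 a : (a <= D)%N -> (sphere_size a)%:R != 0 :> R.
Proof.
case/sphere_nonempty=> j <-; rewrite pnatr_eq0 -lt0n.
by apply/card_gt0P; exists j; rewrite inE.
Qed.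

Lemma sum_sphere a : \sum_j (d j == a)%:R = (sphere_size a)%:R :> R.
Proof.
rewrite /sphere_size -(sum1_card [pred j : 'I_n | d j == a]) natr_sum.
rewrite [RHS]big_mkcond.
by apply: eq_bigr => j _; rewrite inE; case: eqP.
Qed.

Lemma primary_proj_sym : primary_proj^T = primary_proj.
Proof.
by apply/matrixP => j k; rewrite !mxE eq_sym; case: eqP => // ->.
Qed.

Lemma neighbour_numbers : exists N : nat -> nat -> nat, forall j a,
  (a <= D)%N -> (\sum_w ((vdist j w == 1) && (d w == a)) = N (d j) a)%N.
Proof.
have [p p_eq] := intersection_numbers.
exists (fun b a => p b a 1%N) => j a aD; rewrite -p_eq //.
by apply: eq_bigr => w _; rewrite andbC (vdist_sym w j).
Qed.

Lemma adj_primary_projE (N : nat -> nat -> nat) :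
  (forall j a, (a <= D)%N ->
     (\sum_w ((vdist j w == 1) && (d w == a)) = N (d j) a)%N) ->
  forall j k, (A *m primary_proj) j k =
    (N (d j) (d k))%:R / (sphere_size (d k))%:R.
Proof.
move=> N_eq j k; rewrite -N_eq ?vdist_diam // natr_sum mulr_suml mxE.
apply: eq_bigr => w _; rewrite adj_mxE !mxE -mulnb natrM -mulrA.
by congr (_ * _); case: eqP => [->|_]; rewrite ?mul1r ?mul0r.
Qed.

(** The claim is that [A *m primary_proj] is symmetric, which follows by counting the edges between
    two spheres from either side. *)
Lemma primary_proj_adj : primary_proj *m A = A *m primary_proj.
Proof.
rewrite -[LHS]trmxK trmx_mul primary_proj_sym adj_mx_sym.
have [N N_eq] := neighbour_numbers.
apply/matrixP => j k; rewrite mxE !(adj_primary_projE N_eq).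
have balance a b : (a <= D)%N -> (b <= D)%N ->
    (N a b)%:R * (sphere_size a)%:R = (N b a)%:R * (sphere_size b)%:R :> R.
  move=> aD bD.
  have count u v : (v <= D)%N -> (N u v)%:R * (sphere_size u)%:R =
      \sum_j \sum_w ((d j == u) * ((vdist j w == 1) && (d w == v)))%:R :> R.
    move=> vD; rewrite -sum_sphere mulr_sumr; apply: eq_bigr => l _.
    under [RHS]eq_bigr do rewrite natrM; rewrite -mulr_sumr mulrC.
    by case: eqP => [<-|_]; rewrite ?mul0r // !mul1r -natr_sum N_eq.
  rewrite !count // exchange_big; apply: eq_bigr => j' _; apply: eq_bigr => w _.
  by rewrite !mulnb (vdist_sym w j'); case: (d w == a); case: (d j' == b); rewrite ?andbF.
apply: (mulIf (sphere_size_neq0 (vdist_diam r k))).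
apply: (mulIf (sphere_size_neq0 (vdist_diam r j))).
rewrite mulfVK ?sphere_size_neq0 ?vdist_diam //.
by rewrite -balance ?vdist_diam // mulrAC mulfVK ?sphere_size_neq0 ?vdist_diam.
Qed.

Lemma primary_proj_dual a :
  primary_proj *m dual_idem e R x a = dual_idem e R x a *m primary_proj.
Proof.
have L j k : (dual_idem e R x a *m primary_proj) j k =
    (d j == a)%:R * primary_proj j k.
  rewrite dual_idemE mxE (bigD1 j) //= big1 ?addr0 ?mxE ?eqxx // => i ij.
  by rewrite !mxE eq_sym (negPf ij) mul0r.
rewrite -[LHS]trmxK trmx_mul primary_proj_sym dual_idem_sym.
apply/matrixP => j k; rewrite mxE !L !mxE (eq_sym (d k) (d j)).
by case: (eqVneq (d j) (d k)) => [->|_]; rewrite ?mulr0.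
Qed.

Lemma primary_proj_idem : primary_proj *m primary_proj = primary_proj.
Proof.
apply/matrixP => j k; rewrite mxE.
transitivity (\sum_i (d i == d j)%:R *
    ((sphere_size (d j))%:R^-1 * primary_proj j k)).
  apply: eq_bigr => i _; rewrite !mxE eq_sym; case: eqP => [->|_]; rewrite ?mul0r //.
  by rewrite mul1r.
rewrite -mulr_suml sum_sphere mulrA mulfV ?mul1r //.
by rewrite sphere_size_neq0 ?vdist_diam.
Qed.

(** The sphere of radius 0 is {x}. With [primary_proj_idem0] this removes index 0 from both families
    on the complement of the primary module. *)
Lemma primary_proj_dual0 : dual_idem e R x 0 *m primary_proj = dual_idem e R x 0.
Proof.
have d0 j : (d j == 0%N) = (j == r) by rewrite vdist_eq0 eq_sym.
have s0 : sphere_size 0 = 1%N.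
  by rewrite /sphere_size -(card1 r); apply: eq_card => j; rewrite !inE d0.
apply/matrixP => j k; rewrite dual_idemE mxE (bigD1 j) //= big1 => [|i ij].
  rewrite !mxE eqxx addr0 /= d0; case: (eqVneq j r) => [->|_].
    have /eqP-> : d r == 0%N by rewrite d0.
    by rewrite mul1r andbT eq_sym d0 eq_sym s0 invr1; case: (r == k).
  by rewrite mul0r andbF.
by rewrite !mxE eq_sym (negPf ij) mul0r.
Qed.

Lemma primary_proj_idem0 : E ord0 *m primary_proj = E ord0.
Proof.
have [a ->] := idem0 x; rewrite -scalemxAl; congr (_ *: _).
apply/matrixP => j k; rewrite !mxE.
transitivity (\sum_i (d i == d k)%:R / (sphere_size (d k))%:R : R).
  apply: eq_bigr => i _; rewrite !mxE mul1r.
  by case: eqP => [->|_]; rewrite ?mul1r ?mul0r.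
by rewrite -mulr_suml sum_sphere mulfV // sphere_size_neq0 ?vdist_diam.
Qed.

Section Shells.
Variable F : fieldType.

Definition shell_constant : set 'M[F]_n :=
  fun M => exists c : nat -> nat -> F, forall j k, M j k = c (d j) (d k).

Lemma shell_constant_lin : lin_closed shell_constant.
Proof.
split=> [|a B C [b Bb] [c Cc]]; first by exists (fun _ _ => 0) => j k; rewrite mxE.
by exists (fun u v => a * b u v + c u v) => j k; rewrite !mxE Bb Cc.
Qed.

Lemma shell_constant_mul M N :
  shell_constant M -> shell_constant N -> shell_constant (M *m N).
Proof.
move=> [b Mb] [c Nc]; exists (fun u v => \sum_w b u (d w) * c (d w) v) => j k.
by rewrite mxE; apply: eq_bigr => w _; rewrite Mb Nc.
Qed.

Lemma shell_constant_dual M a :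
  shell_constant M -> shell_constant (dual_idem e F x a *m M).
Proof.
case=> c Mc; exists (fun u v => (u == a)%:R * c u v) => j k.
rewrite dual_idemE mxE (bigD1 j) //= big1 ?addr0 ?mxE ?eqxx ?Mc // => i ij.
by rewrite !mxE eq_sym (negPf ij) mul0r.
Qed.

(** The block of ones between the spheres a and b is $A_aE_0^*A_b$, with $A_a$ the distance matrix.
    In this form a primitive idempotent absorbs the outer factors. *)
Lemma shell_constant_sum M : shell_constant M ->
  exists c : nat -> nat -> F, M = \sum_(a < D.+1) \sum_(b < D.+1)
    c a b *: (dist_mx F a *m dual_idem e F x 0 *m dist_mx F b).
Proof.
case=> c Mc; exists c; apply/matrixP => j k.
have entry a b : (dist_mx F a *m dual_idem e F x 0 *m dist_mx F b) j k =
    ((d j == a) && (d k == b))%:R.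
  have d0 i : (d i == 0%N) = (i == r) by rewrite vdist_eq0 eq_sym.
  rewrite -mulmxA mxE (bigD1 r) //= big1 => [|i ir].
    rewrite addr0 dual_idemE [X in _ * X]mxE (bigD1 r) //= big1 => [|i ir].
      by rewrite !mxE eqxx d0 eqxx mul1r addr0 vdist_sym -natrM mulnb.
    by rewrite !mxE eq_sym (negPf ir) mul0r.
  rewrite dual_idemE [X in _ * X]mxE big1 ?mulr0 // => l _.
  by rewrite !mxE d0 (negPf ir) andbF mul0r.
have jD : (d j < D.+1)%N by rewrite ltnS vdist_diam.
have kD : (d k < D.+1)%N by rewrite ltnS vdist_diam.
rewrite summxE (bigD1 (Ordinal jD)) //= summxE (bigD1 (Ordinal kD)) //=.
rewrite mxE entry !eqxx mulr1 Mc !big1 ?addr0 // => [a aj|b bk].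
  rewrite summxE big1 // => b _; rewrite mxE entry.
  rewrite (_ : (d j == a) = false) ?mulr0 //; apply: contraNF aj => /eqP aj.
  by apply/eqP/ord_inj.
rewrite mxE entry (_ : (d k == b) = false) ?andbF ?mulr0 //.
by apply: contraNF bk => /eqP bk; apply/eqP/ord_inj.
Qed.

End Shells.

Lemma shell_constant_primary : shell_constant primary_proj.
Proof.
by exists (fun u v => if u == v then (sphere_size u)%:R^-1 else 0) => j k; rewrite mxE.
Qed.

Lemma shell_constant_adj_primary : shell_constant (A *m primary_proj).
Proof.
have [N N_eq] := neighbour_numbers.
exists (fun u v => (N u v)%:R / (sphere_size v)%:R).
exact: adj_primary_projE.
Qed.

(** * The tridiagonal system on the complement of the primary module *)

Definition nonprimary : 'M[R]_n := 1%:M - primary_proj.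

Lemma nonprimary_sym : nonprimary^T = nonprimary.
Proof. by rewrite linearB /= trmx1 primary_proj_sym. Qed.

Lemma nonprimary_idem : nonprimary *m nonprimary = nonprimary.
Proof.
rewrite mulmxBr mulmx1 mulmxBl mul1mx primary_proj_idem.
by rewrite subrr subr0.
Qed.

Lemma nonprimary_comm (M : 'M[R]_n) :
  primary_proj *m M = M *m primary_proj -> nonprimary *m M = M *m nonprimary.
Proof. by move=> PM; rewrite mulmxBl mulmxBr mul1mx mulmx1 PM. Qed.

Lemma primary_proj_comm_idem i :
  primary_proj *m E i = E i *m primary_proj.
Proof.
apply: (@idem_closed (fun M : 'M[R]_n => primary_proj *m M = M *m primary_proj)).
split=> [||B PB]; last by rewrite mulmxA primary_proj_adj -!mulmxA PB.
- split=> [|a B C PB PC]; first by rewrite mulmx0 mul0mx.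
  by rewrite mulmxDr mulmxDl -scalemxAr -scalemxAl PB PC.
- by rewrite mulmx1 mul1mx.
Qed.

(** Index i stands for i + 1, since both idempotents of index 0 vanish on this complement. *)
Definition graph_idem (b : bool) (i : 'I_D) : 'M[R]_n :=
  (if b then E (lift ord0 i) else dual_idem e R x i.+1) *m nonprimary.

Lemma sum_graph_idem b : \sum_i graph_idem b i = nonprimary.
Proof.
rewrite -mulmx_suml; case: b.
  have := idem_sum1; rewrite big_ord_recl addrC => /esym/eqP.
  rewrite -subr_eq => /eqP <-.
  by rewrite mulmxBl mul1mx [X in _ - X]mulmxBr mulmx1 primary_proj_idem0 subrr subr0.
have := dual_idem_sum1 R; rewrite big_ord_recl addrC => /esym/eqP.
rewrite -subr_eq => /eqP <-.
by rewrite mulmxBl mul1mx [X in _ - X]mulmxBr mulmx1 primary_proj_dual0 subrr subr0.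
Qed.

Lemma mul_nonprimary (M N : 'M[R]_n) : nonprimary *m N = N *m nonprimary ->
  (M *m nonprimary) *m (N *m nonprimary) = M *m N *m nonprimary.
Proof. by move=> pN; rewrite mulmxA -(mulmxA M) pN -!mulmxA nonprimary_idem. Qed.

Let p_idem i := nonprimary_comm (primary_proj_comm_idem i).
Let p_dual a := nonprimary_comm (primary_proj_dual a).

(** The [true] operator comes from A, which moves between neighbouring spheres; the [false] one
    comes from [dual_adj], tridiagonal by the Q-polynomial property. *)
Lemma graph_tridiagonal_system : exists ths : 'I_D -> R,
  let th b := if b then fun i => theta (lift ord0 i) else ths in
  tridiagonal_system graph_idem th /\
  spev (graph_idem true) (th true) 'X = A *m nonprimary.
Proof.
have [ths [ths_inj dadjE]] := dual_adj_eigenvalues.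
exists (fun i => ths (lift ord0 i)) => th.
have adjE : A = \sum_i theta i *: E i.
  rewrite -[A]mulmx1 -idem_sum1 mulmx_sumr.
  by apply: eq_bigr => i _; rewrite adj_mul_idem.
have p_adj : nonprimary *m A = A *m nonprimary.
  by apply/nonprimary_comm/primary_proj_adj.
have p_dadj : nonprimary *m dual_adj = dual_adj *m nonprimary.
  rewrite dadjE mulmx_sumr mulmx_suml; apply: eq_bigr => i _.
  by rewrite -scalemxAr -scalemxAl p_dual.
have evT : spev (graph_idem true) (th true) 'X = A *m nonprimary.
  rewrite adjE big_ord_recl mulmxDl -scalemxAl mulmxBr mulmx1 primary_proj_idem0.
  rewrite subrr scaler0 add0r mulmx_suml; apply: eq_bigr => i _.
  by rewrite hornerX -scalemxAl.
have evF : spev (graph_idem false) (th false) 'X = dual_adj *m nonprimary.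
  rewrite dadjE big_ord_recl mulmxDl -scalemxAl mulmxBr mulmx1 primary_proj_dual0.
  rewrite subrr scaler0 add0r mulmx_suml; apply: eq_bigr => i _.
  by rewrite hornerX -scalemxAl.
split=> //; split=> [[]||[] i j ij].
- split=> [i j /theta_inj/lift_inj //|i|i j].
    by rewrite trmx_mul nonprimary_sym idem_sym p_idem.
  rewrite mul_nonprimary ?p_idem // idem_mul (inj_eq lift_inj).
  by case: ifP => // _; rewrite mul0mx.
- split=> [i j /ths_inj/lift_inj //|i|i j].
    by rewrite trmx_mul nonprimary_sym dual_idem_sym p_dual.
  rewrite mul_nonprimary ?p_dual // dual_idem_mul eqSS (inj_eq val_inj).
  by case: ifP => // _; rewrite mul0mx.
- by rewrite !sum_graph_idem.
- by rewrite /= evF !mul_nonprimary ?p_idem // dual_adj_band ?mul0mx //.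
- by rewrite /= evT !mul_nonprimary ?p_dual // dual_idem_band ?mul0mx.
Qed.

(** * Extension of scalars and the four corners *)

Section BaseChange.
Variables (F : fieldType) (phi : {rmorphism R -> F}).

Notation T := (terwilliger e F x).
Notation p := (map_mx phi nonprimary).
Notation pp := (map_mx phi primary_proj).
Notation EF i := (map_mx phi (E i)).
Notation Es := (dual_idem e F x).

Lemma map_adj_mx : map_mx phi A = adj_mx e F.
Proof. by apply/matrixP => j k; rewrite !mxE rmorph_nat. Qed.

Lemma map_dual_idem a : map_mx phi (dual_idem e R x a) = Es a.
Proof. by apply/matrixP => j k; rewrite !mxE rmorph_nat. Qed.

Lemma map_dist_mx a : map_mx phi (dist_mx R a) = dist_mx F a.
Proof. by apply/matrixP => j k; rewrite !mxE rmorph_nat. Qed.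

Lemma map_nonprimary : p = 1%:M - pp.
Proof. by rewrite raddfB /= map_mx1. Qed.

Lemma nonprimary_terwilliger B : T B -> p *m B = B *m p.
Proof.
apply: gensub_comm => C [->|[i _ ->]].
  rewrite -map_adj_mx -!map_mxM; congr map_mx.
  exact/nonprimary_comm/primary_proj_adj.
by rewrite -map_dual_idem -!map_mxM p_dual.
Qed.

Lemma shell_constant_terwilliger B : T B -> shell_constant (B *m pp).
Proof.
have pp_shell : shell_constant pp.
  by have [c cE] := shell_constant_primary; exists (fun u v => phi (c u v)) => j k;
    rewrite mxE cE.
have ppC C : T C -> pp *m C = C *m pp.
  move=> /nonprimary_terwilliger; rewrite map_nonprimary mulmxBl mulmxBr.
  by rewrite mul1mx mulmx1 => /addrI/oppr_inj.
have pp_idem : pp *m pp = pp by rewrite -map_mxM primary_proj_idem.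
elim=> {B} [C [->|[i _ ->]]||a C _ IH|C C' _ IH _ IH'|C C' _ IH TC' IH'].
- have [c cE] := shell_constant_adj_primary; exists (fun u v => phi (c u v)) => j k.
  by rewrite -map_adj_mx -map_mxM mxE cE.
- exact: shell_constant_dual.
- by rewrite mul1mx.
- by rewrite -scalemxAl; apply: (lin_closedZ _ (@shell_constant_lin _)).
- by rewrite mulmxDl; apply: (lin_closedD (@shell_constant_lin _)).
- have -> : C *m C' *m pp = (C *m pp) *m (C' *m pp).
    by rewrite -[RHS]mulmxA (mulmxA pp) (ppC _ TC') -(mulmxA C') pp_idem mulmxA.
  exact: shell_constant_mul.
Qed.

Lemma corner_dual_shell M a :
  shell_constant M -> (Es a *m M *m Es a)^T = Es a *m M *m Es a.
Proof.
case=> c Mc; apply/matrixP => j k; rewrite mxE.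
suff entry u v : (Es a *m M *m Es a) u v = ((d u == a) && (d v == a))%:R * c a a.
  by rewrite !entry andbC.
rewrite dual_idemE mxE (bigD1 v) //= big1 => [|i iv]; last first.
  by rewrite [X in _ * X]mxE (negPf iv) mulr0.
rewrite addr0 [X in X * _]mxE (bigD1 u) //= big1 => [|i iu]; last first.
  by rewrite !mxE eq_sym (negPf iu) mul0r.
rewrite !mxE !eqxx addr0 Mc /=.
case: (eqVneq (d u) a) => [->|_]; last by rewrite !mul0r.
by case: (eqVneq (d v) a) => [->|_]; rewrite !(mul1r, mulr1, mulr0, mul0r).
Qed.

(** Distance matrices act on [EF i] as scalars, so the corner consists of multiples of
    [EF i *m Es 0 *m EF i]. *)
Lemma corner_idem_shell M i :
  shell_constant M -> (EF i *m M *m EF i)^T = EF i *m M *m EF i.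
Proof.
move=> /shell_constant_sum[c ->].
have EF_sym : (EF i)^T = EF i by rewrite map_trmx idem_sym.
have dist_sym a : (dist_mx F a)^T = dist_mx F a.
  by apply/matrixP => j k; rewrite !mxE vdist_sym.
have distE a : exists l, dist_mx F a *m EF i = l *: EF i.
  have [l lE] := distance_constant_mul_idem i (dist_mx_const R a).
  by exists (phi l); rewrite -map_dist_mx -map_mxM lE map_mxZ.
pose sym (N : 'M[F]_n) := (EF i *m N *m EF i)^T = EF i *m N *m EF i.
have sym_lin : lin_closed sym.
  split; rewrite /sym; first by rewrite mulmx0 mul0mx trmx0.
  move=> a B C Bs Cs; rewrite mulmxDr mulmxDl linearD /= Cs.
  by rewrite -scalemxAr -scalemxAl linearZ /= Bs.
apply: (lin_closed_sum _ sym_lin) => a _; apply: (lin_closed_sum _ sym_lin) => b _.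
apply: (lin_closedZ _ sym_lin); rewrite /sym.
have [[l lE] [k kE]] := (distE a, distE b).
have El : EF i *m dist_mx F a = l *: EF i.
  by rewrite -[LHS]trmxK trmx_mul EF_sym dist_sym lE linearZ /= EF_sym.
rewrite !mulmxA El -(mulmxA _ _ (EF i)) kE -!(scalemxAl, scalemxAr).
by rewrite !linearZ /= !trmx_mul EF_sym dual_idem_sym mulmxA !scalerA mulrC.
Qed.

Variables (c : bool) (rv : bool -> bool) (i0 : 'I_D).
Hypothesis i0_0 : i0 = 0%N :> nat.

Let g := variant c rv (fun b i => map_mx phi (graph_idem b i)).

(** [K *m B *m K] splits along [p] and [pp]. The first part lies in the corner at the initial
    idempotent of the tridiagonal system, the second is covered by the hypothesis on shell-constant
    matrices. *)
Lemma corner_symmetric (K : 'M[F]_n) :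
  p *m K = K *m p -> K *m p = g false i0 ->
  (forall M, shell_constant M -> (K *m M *m K)^T = K *m M *m K) ->
  symmetric_set (corner K T).
Proof.
move=> pK Kg Kshell _ [B TB <-].
have [ths [td evA]] := graph_tridiagonal_system.
pose h b i := map_mx phi (graph_idem b i).
pose t b i := phi ((if b then fun i => theta (lift ord0 i) else ths) i).
have tdF : tridiagonal_system h t := tridiagonal_system_map phi td.
pose th := variant c rv t.
have tdV : tridiagonal_system g th := tridiagonal_system_variant c rv tdF.
have pM : p *m p = p by rewrite -map_mxM nonprimary_idem.
have span_ev b P : td_span g th (spev (h b) (t b) P).
  have -> : b = c (+) (c (+) b) by rewrite addbA addbb.
  by rewrite -(spev_variant h t c rv); apply: td_span_ev.
have TBp : td_span g th (B *m p).
  elim: TB => {B} [C [->|[i iD ->]]||a C _ IH|C C' _ IH _ IH'|C C' _ IH TC' IH'].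
  - have := span_ev true 'X; congr (td_span g th _).
    rewrite -map_adj_mx -map_mxM -evA raddf_sum; apply: eq_bigr => i _.
    by rewrite !hornerX /= map_mxZ.
  (* [Es 0] is killed by [p]; every other [Es] becomes a member of the [false] family. *)
  - case: i iD => [_|i iD].
      rewrite -map_dual_idem -map_mxM mulmxBr mulmx1 primary_proj_dual0 subrr raddf0.
      by case: (td_span_lin g th).
    have [P eP] := idem_spev (td_spectral tdF false) (Ordinal iD).
    by have := span_ev false P; rewrite eP /h map_mxM map_dual_idem.
  - have := span_ev true 1; congr (td_span g th _).
    by rewrite spev1 -raddf_sum sum_graph_idem mul1mx.
  - by rewrite -scalemxAl; apply: (lin_closedZ _ (td_span_lin g th)).
  - by rewrite mulmxDl; apply: (lin_closedD (td_span_lin g th)).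
  - have -> : C *m C' *m p = (C *m p) *m (C' *m p).
      rewrite -[RHS]mulmxA (mulmxA p) (nonprimary_terwilliger TC') -(mulmxA C').
      by rewrite pM mulmxA.
    exact: td_span_mul.
have := td_corner_symmetric tdV i0_0 TBp; rewrite -/g -Kg => sym_p.
have split_B : K *m B *m K =
    K *m p *m (B *m p) *m (K *m p) + K *m (B *m pp) *m K.
  have -> : K *m p *m (B *m p) *m (K *m p) = K *m (B *m p) *m K.
    transitivity (K *m B *m K *m p); last by rewrite -!mulmxA pK.
    rewrite -!mulmxA (mulmxA p B) (nonprimary_terwilliger TB) -!mulmxA.
    by rewrite (mulmxA p p) pM (mulmxA p K) pK -(mulmxA K p p) pM.
  by rewrite -mulmxDl -mulmxDr -mulmxDr map_nonprimary subrK mulmx1.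
rewrite split_B linearD /= sym_p; congr (_ + _).
exact/Kshell/shell_constant_terwilliger.
Qed.

(** As K lies in T, the corner is closed under products, so M N is symmetric as well and equals its
    transpose N M. *)
Lemma corner_commutative (K : 'M[F]_n) :
  T K -> symmetric_set (corner K T) -> commutative_set (corner K T).
Proof.
move=> TK sym M N KM KN; have [B TB eM] := KM; have [C TC eN] := KN.
have KMN : corner K T (M *m N).
  exists (B *m (K *m (K *m C))); first by do !apply: gensub_mul => //.
  by rewrite -eM -eN !mulmxA.
by rewrite -[LHS](sym _ KMN) trmx_mul (sym _ KM) (sym _ KN).
Qed.

Lemma terwilliger_idem i : T (EF i).
Proof.
apply: (@idem_closed (fun M => T (map_mx phi M))).
split=> [||B TB]; last 1 first.
- rewrite map_mxM; apply: gensub_mul => //.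
  by apply: gensub_gen; left; rewrite map_adj_mx.
- split=> [|a B C TB TC]; first by rewrite raddf0; apply: (proj1 (gensub_lin _)).
  by rewrite raddfD /= map_mxZ; apply: gensub_add => //; apply: gensub_scale.
- by rewrite map_mx1; apply: gensub_one.
Qed.

End BaseChange.

Lemma corner_symmetric_all (F : fieldType) (phi : {rmorphism R -> F})
    (T := terwilliger e F x) :
  [/\ symmetric_set (corner (dual_idem e F x 1) T),
      symmetric_set (corner (map_mx phi (E one)) T),
      symmetric_set (corner (dual_idem e F x D) T) &
      symmetric_set (corner (map_mx phi (E ord_max)) T)].
Proof.
pose i0 : 'I_D := Ordinal D_gt0.
have i0_0 : i0 = 0%N :> nat by [].
have p_dualF a : map_mx phi nonprimary *m dual_idem e F x a =
    dual_idem e F x a *m map_mx phi nonprimary.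
  by rewrite -(map_dual_idem phi) -!map_mxM p_dual.
have p_idemF i : map_mx phi nonprimary *m map_mx phi (E i) =
    map_mx phi (E i) *m map_mx phi nonprimary.
  by rewrite -!map_mxM p_idem.
have oneE : one = lift ord0 i0 by apply: ord_inj; rewrite one1.
have maxE : ord_max = lift ord0 (rev_ord i0).
  by apply: ord_inj; rewrite /= subn1 /bump /= add1n prednK.
have DE : D = (rev_ord i0).+1 by rewrite /= subn1 prednK.
(* The boolean [c] puts the family of K first and [rv] reverses the orders; [i0] stands for index 1
   and [rev_ord i0] for index D. *)
split.
- apply: (@corner_symmetric F phi false (fun=> false) i0) => //.
    by rewrite -(map_dual_idem phi) -map_mxM.
  by move=> M; apply: corner_dual_shell.
- apply: (@corner_symmetric F phi true (fun=> false) i0) => //.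
    by rewrite oneE -map_mxM.
  by move=> M; apply: corner_idem_shell.
- apply: (@corner_symmetric F phi false (fun=> true) i0) => //.
    by rewrite {1}DE -(map_dual_idem phi) -map_mxM.
  by move=> M; apply: corner_dual_shell.
- apply: (@corner_symmetric F phi true (fun=> true) i0) => //.
    by rewrite maxE -map_mxM.
  by move=> M; apply: corner_idem_shell.
Qed.

End BoseMesner.

Theorem theorem1p6 (R : realType) (k : scalars)
    (X : finType) (e : rel X)
    (e_sym : symmetric e) (e_irr : irreflexive e)
    (e_conn : forall y z : X, connect e y z)
    (e_dr : distance_regular e)
    (D_ge3 : (3 <= diameter e)%N)
    (theta : 'I_(diameter e).+1 -> R)
    (theta_eig : eigenvalue_ordering theta)
    (E : 'I_(diameter e).+1 -> 'M[R]_#|X|)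
    (E_idem : primitive_idempotents theta E)
    (E_Qpol : Q_polynomial E)
    (x : X) :
  let F := scalar_field R k in
  let T : set 'M[F]_#|X| := terwilliger e F x in
  let Es (i : nat) : 'M[F]_#|X| := dual_idem e F x i in
  let EF (i : 'I_(diameter e).+1) : 'M[F]_#|X| := map_mx (of_real k) (E i) in
  [/\ commutative_set (corner (Es 1%N) T),
      commutative_set (corner (EF (inord 1)) T),
      commutative_set (corner (Es (diameter e)) T) &
      commutative_set (corner (EF ord_max) T)] /\
  [/\ symmetric_set (corner (Es 1%N) T),
      symmetric_set (corner (EF (inord 1)) T),
      symmetric_set (corner (Es (diameter e)) T) &
      symmetric_set (corner (EF ord_max) T)].

Proof.
move=> F T Es EF.
have D_gt0 : (0 < diameter e)%N by apply: leq_trans D_ge3.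
suff [phi phiE] : exists phi : {rmorphism R -> F}, of_real k = phi :> (R -> F).
  have [s1 s2 s3 s4] := corner_symmetric_all e_sym e_irr e_conn e_dr theta_eig
    E_idem D_gt0 E_Qpol x phi.
  have T_dual i : (i <= diameter e)%N -> T (Es i).
    by move=> iD; apply: gensub_gen; right; exists i.
  have T_idem := terwilliger_idem e_sym e_irr e_conn e_dr theta_eig E_idem x phi.
  rewrite /EF phiE; split; split=> //; apply: corner_commutative => //.
  - by apply: T_dual; apply: leq_trans D_ge3.
  - by apply: T_dual.
by rewrite /F; case: (k) => /=; [exists idfun | exists (real_complex R)].
Qed.
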